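(* Let $\mathcal M$ be a von Neumann algebra acting on a finite-dimensional Hilbert space $h$, and let $P=(P_t)_{t\ge0}$ be a continuous, positive, identity-preserving semigroup on $\mathcal M$ with a faithful invariant density $\rho$, symmetric with respect to the scalar product $\langle f,g\rangle=\mathrm{tr}(\rho^{1/2}f^*\rho^{1/2}g)$. Let $c$ be a real constant. Then the following conditions are equivalent: a) $E(P_tf)\le e^{-ct}E(f)$ for all $t\ge0$ and all strictly positive $f\in\mathcal M$; b) $c\,E(f)\le \mathcal E\big(\log(\rho^{1/2}f\rho^{1/2})-\log\rho,\;f\big)$ for all strictly positive $f\in\mathcal M$.
   Context: $\mathrm{tr}$ is the usual trace on operators on $h$. The semigroup $P=(P_t)_{t\ge0}$ consists of linear maps $P_t:\mathcal M\to\mathcal M$ with $P_0=\mathrm{id}$, $P_{t+s}=P_tP_s$, $t\mapsto P_t$ continuous, $P_t(f)\ge0$ whenever $f\ge0$, and $P_t(\mathbf 1)=\mathbf 1$. The faithful invariant density $\rho\in\mathcal M$ is strictly positive (invertible) with $\mathrm{tr}(\rho)=1$ and $\mathrm{tr}(\rho P_tf)=\mathrm{tr}(\rho f)$ for all $t\ge 0$, $f\in\mathcal M$. Symmetry means $\langle P_tf,g\rangle=\langle f,P_tg\rangle$ for all $f,g\in\mathcal M$, $t\ge0$. $\mathcal L$ denotes the infinitesimal generator of $P$, and $$\mathcal E(f,g)=-\langle f,\mathcal Lg\rangle=-\mathrm{tr}(\rho^{1/2}f^*\rho^{1/2}\mathcal Lg).$$ For $f\in\mathcal M$, $\|f\|_1=\mathrm{tr}(|\rho^{1/2}f\rho^{1/2}|)$.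 For strictly positive $f\in\mathcal M$ (i.e. $f\geq\varepsilon\mathbf 1$ for some $\varepsilon>0$), the relative entropy of $f$ is $$E(f)=\mathrm{tr}\big(\rho^{1/2}f\rho^{1/2}(\log(\rho^{1/2}f\rho^{1/2})-\log\rho)\big)-\|f\|_1\log\|f\|_1.$$ $\log$ is the natural logarithm (functional calculus for operators). *)

(* Defs.v *)
From HB Require Import structures.
From mathcomp Require Import all_boot all_order all_algebra.
From mathcomp Require Import all_classical all_reals all_analysis.
From mathcomp Require Import complex.

Set Implicit Arguments.
Unset Strict Implicit.
Unset Printing Implicit Defensive.

Import Order.TTheory GRing.Theory Num.Theory.
Import numFieldNormedType.Exports.

Local Open Scope classical_set_scope.
Local Open Scope ring_scope.
Local Open Scope sesquilinear_scope.
Local Open Scope complex_scope.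

(* The library gives [R[i]] no topology; this is the one of its norm, and the
   matrix spaces ['M[R[i]]_n] inherit theirs from it. *)
HB.instance Definition _ (R : rcfType) := NormedModule.copy R[i] (R[i])^o.

(* The finite-dimensional Hilbert space is C^n, with column vectors and the
   standard inner product; its operators are the n x n complex matrices, the
   adjoint is [^t*] and the usual trace is [\tr]. *)

Definition commutant (R : realType) (n : nat) (S : set 'M[R[i]]_n) :
    set 'M[R[i]]_n :=
  [set a | forall b, S b -> a *m b = b *m a].

(* The bicommutant condition makes [M] a linear subspace, closed under products
   and containing the identity. *)
Definition von_neumann_algebra (R : realType) (n : nat)
    (M : set 'M[R[i]]_n) : Prop :=
  (forall a, M a -> M (a ^t*)) /\ commutant (commutant M) = M.

(* In [R[i]], [0 <= z] says that [z] is real and nonnegative, so a positive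
   matrix is Hermitian. *)
Definition psd (R : realType) (n : nat) (a : 'M[R[i]]_n) : Prop :=
  forall v : 'cV[R[i]]_n, 0 <= (v ^t* *m a *m v) 0 0.

Definition strictly_positive (R : realType) (n : nat) (a : 'M[R[i]]_n) : Prop :=
  exists2 eps : R, 0 < eps & psd (a - (eps%:C)%:M).

(* Functional calculus; meaningful for normal [a], where
   [a = invmx U *m diag_mx d *m U] with [U] the unitary [spectralmx a] and [d]
   the eigenvalues [spectral_diag a]. *)
Definition fun_calculus (R : realType) (n : nat) (phi : R[i] -> R[i])
    (a : 'M[R[i]]_n) : 'M[R[i]]_n :=
  invmx (spectralmx a) *m diag_mx (map_mx phi (spectral_diag a))
    *m spectralmx a.

(* Only used at positive reals. *)
Definition clog (R : realType) (z : R[i]) : R[i] := (ln (complex.Re z))%:C.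

Definition sqrtm (R : realType) (n : nat) (a : 'M[R[i]]_n) : 'M[R[i]]_n :=
  fun_calculus sqrtC a.

Definition logm (R : realType) (n : nat) (a : 'M[R[i]]_n) : 'M[R[i]]_n :=
  fun_calculus (@clog R) a.

Definition absm (R : realType) (n : nat) (a : 'M[R[i]]_n) : 'M[R[i]]_n :=
  sqrtm (a ^t* *m a).

(* A linear map of [M] is represented by a function on all matrices of which
   only the values on [M] matter; likewise only times [0 <= t] matter. *)
Record positive_unital_semigroup (R : realType) (n : nat)
    (M : set 'M[R[i]]_n) (P : R -> 'M[R[i]]_n -> 'M[R[i]]_n) : Prop :=
  PositiveUnitalSemigroup {
    semigroup_stable : forall t f, 0 <= t -> M f -> M (P t f);
    semigroup_linear : forall t (k : R[i]) f g, 0 <= t -> M f -> M g ->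
      P t (k *: f + g) = k *: P t f + P t g;
    semigroup_id : forall f, M f -> P 0 f = f;
    semigroup_add : forall s t f, 0 <= s -> 0 <= t -> M f ->
      P (t + s) f = P t (P s f);
    semigroup_continuous : forall f, M f ->
      {within `[0, +oo[, continuous (fun t : R => P t f)};
    semigroup_positive : forall t f, 0 <= t -> M f -> psd f -> psd (P t f);
    semigroup_unital : forall t, 0 <= t -> P t 1%:M = 1%:M
  }.

Record faithful_invariant_density (R : realType) (n : nat)
    (M : set 'M[R[i]]_n) (P : R -> 'M[R[i]]_n -> 'M[R[i]]_n)
    (rho : 'M[R[i]]_n) : Prop :=
  FaithfulInvariantDensity {
    density_mem : M rho;
    density_faithful : strictly_positive rho;
    density_trace : \tr rho = 1;
    density_invariant : forall t f, 0 <= t -> M f ->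
      \tr (rho *m P t f) = \tr (rho *m f)
  }.

Definition rho_dot (R : realType) (n : nat) (rho f g : 'M[R[i]]_n) : R[i] :=
  \tr (sqrtm rho *m f ^t* *m sqrtm rho *m g).

Definition symmetric_semigroup (R : realType) (n : nat)
    (M : set 'M[R[i]]_n) (P : R -> 'M[R[i]]_n -> 'M[R[i]]_n)
    (rho : 'M[R[i]]_n) : Prop :=
  forall t f g, 0 <= t -> M f -> M g ->
    rho_dot rho (P t f) g = rho_dot rho f (P t g).

Definition generator (R : realType) (n : nat)
    (P : R -> 'M[R[i]]_n -> 'M[R[i]]_n) (f : 'M[R[i]]_n) : 'M[R[i]]_n :=
  lim ((t^-1)%:C *: (P t f - f) @[t --> (0 : R)^'+]).

Definition dirichlet_form (R : realType) (n : nat)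
    (P : R -> 'M[R[i]]_n -> 'M[R[i]]_n) (rho f g : 'M[R[i]]_n) : R[i] :=
  - rho_dot rho f (generator P g).

Definition rho_weight (R : realType) (n : nat) (rho f : 'M[R[i]]_n) :
    'M[R[i]]_n :=
  sqrtm rho *m f *m sqrtm rho.

Definition norm1 (R : realType) (n : nat) (rho f : 'M[R[i]]_n) : R[i] :=
  \tr (absm (rho_weight rho f)).

(* Complex-valued, but real for strictly positive [f]. *)
Definition relative_entropy (R : realType) (n : nat) (rho f : 'M[R[i]]_n) :
    R[i] :=
  \tr (rho_weight rho f *m (logm (rho_weight rho f) - logm rho))
  - norm1 rho f * clog (norm1 rho f).

(* Main.v *)
Require Import Defs.
From HB Require Import structures.
From mathcomp Require Import all_boot all_order all_algebra.
From mathcomp Require Import all_classical all_reals all_analysis.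
From mathcomp Require Import ring lra.
From mathcomp Require Import complex.

Import Order.TTheory GRing.Theory Num.Theory.
Import numFieldNormedType.Exports.

Local Open Scope classical_set_scope.
Local Open Scope ring_scope.
Local Open Scope complex_scope.
Local Open Scope sesquilinear_scope.

(** Write [s = rho^(1/2)], [w f = s f s] and
    [G f = s (log (w f) - log rho) s].  Then the Dirichlet form of the theorem
    is [- tr (G f * L f)], and Klein's inequality says that the entropy is
    convex with gradient [G]: [E g - E f >= tr (G f * (g - f))] whenever
    [tr (rho g) = tr (rho f)], which holds along the semigroup.  So no
    derivative of the logarithm is needed.
    a) => b): [tr (G f * (P_h f - f)) <= E (P_h f) - E f <= (e^(-ch) - 1) E f];
    divide by [h] and let [h -> 0+].
    b) => a): Klein's inequality at [P_t f] bounds the left difference quotients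
    of [t |-> E (P_t f)] by quantities tending to [tr (G f * L f)] at [P_t f],
    hence the left Dini derivative of [e^(ct) E (P_t f)] is nonpositive.  This
    gives monotonicity once the function is upper semicontinuous from the right,
    which follows from Klein's inequality and a bound for [G] on
    [{f >= e, tr (rho f) = z}].
    The generator exists because a continuous semigroup [Q] of real matrices has
    a primitive [A] with [Q t * A s = A (t + s) - A t], and [A s] is invertible
    for small [s]. *)

(** * Generator of a continuous matrix semigroup *)

(** Freezing the function at its value [q 0] for negative times makes it continuous on the whole
    line, so that two-sided calculus applies at time [0]. *)
Lemma within_continuous_maxr0 (R : realType) (q : R -> R) :
  {within `[0, +oo[, continuous q} -> continuous (fun t : R => q (Num.max 0 t)).
Proof.
move=> /subspace_continuousP qc x.
have mge0 (y : R) : `[0, +oo[%classic (Num.max 0 y).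
  by rewrite /= in_itv /= andbT le_max lexx.
have /= mc : {for x, continuous (fun t : R => Num.max (0 : R) t)}.
  by apply: (@continuous_max _ _ (fun=> 0) id); [exact: cvg_cst|exact: cvg_id].
apply: (@cvg_comp _ _ _ (fun t : R => Num.max 0 t) q _ _ _ _ (qc _ (mge0 x))) => S /= wS.
have : \forall y \near x, `[0, +oo[%classic (Num.max 0 y) -> S (Num.max 0 y) := mc _ wS.
by apply: filterS => y /(_ (mge0 y)).
Qed.

Lemma continuous_primitive (R : realType) (q : R -> R) :
  {within `[0, +oo[, continuous q} ->
  exists2 G : R -> R, G 0 = 0 & forall x : R, 0 <= x -> is_derive x 1 G (q x).
Proof.
move=> qc; have q'c := within_continuous_maxr0 _ _ qc.
set q' := fun t : R => q (Num.max 0 t) in q'c.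
(* The base point [-1] lies strictly to the left of [0], so the fundamental theorem of calculus
   applies at [x = 0] as well. *)
pose F (x : R) := (\int[lebesgue_measure]_(t in `[(-1)%R, x]) q' t)%R.
have dF (x : R) : 0 <= x -> is_derive x 1 F (q x).
  move=> x0.
  have q'i : lebesgue_measure.-integrable `[-1, x + 1] (EFin \o q').
    apply: continuous_compact_integrable; first exact: segment_compact.
    by apply: continuous_subspaceT => y; exact: q'c.
  have [|||] := @continuous_FTC1 _ q' (BLeft (-1)) x (x + 1) _ q'i.
  - by rewrite ltrDl.
  - by rewrite /Order.lt /= ; lra.
  - exact: q'c.
  move=> dF F'; apply: DeriveDef => //.
  by rewrite -derive1E F' /q' max_r.
exists (fun x => F x - F 0); first by rewrite subrr.
move=> x x0; have Fx := dF _ x0.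
by apply: is_derive_eq; rewrite subr0.
Qed.

Lemma cvg_det (R : realType) (k : nat) (F : set_system R) (A : R -> 'M[R]_k)
    (l : 'M[R]_k) : Filter F ->
  (forall i j, A x i j @[x --> F] --> l i j) -> \det (A x) @[x --> F] --> \det l.
Proof.
move=> FF Al; rewrite /determinant.
apply: (@cvg_big R^o) => // [|s _]; first exact: add_continuous.
apply: cvgM; first exact: cvg_cst.
  apply: (@cvg_big R^o) => //; exact: mul_continuous.
Qed.

Lemma right_difference_quotient (R : realType) (G : R -> R) (x d : R) :
  is_derive x 1 G d -> h^-1 * (G (x + h) - G x) @[h --> 0^'+] --> d.
Proof.
move=> [dG <-]; apply: cvg_dnbhs_at_right.
apply: cvg_trans dG; apply: near_eq_cvg; near=> h => /=.
by rewrite /GRing.scale /= mulr1 [h + _]addrC.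
Unshelve. all: by end_near. Qed.

(** For fixed [t], both sides vanish at [s = 0] and have the derivative [Q (t + s)] in [s], so each
    entry of their difference is constant by the mean value theorem. *)
Lemma semigroup_primitive (R : realType) (k : nat) (Q : R -> 'M[R]_k)
    (G : R -> 'M[R]_k) :
  (forall s t, 0 <= s -> 0 <= t -> Q (s + t) = Q s *m Q t) -> G 0 = 0 ->
  (forall i j (x : R), 0 <= x -> is_derive x 1 (fun y => G y i j) (Q x i j)) ->
  forall t s, 0 <= t -> 0 <= s -> Q t *m G s = G (t + s) - G t.
Proof.
move=> Qadd G0 dG t s t0 s0; apply/matrixP => i j.
pose phi := \sum_(l < k) (Q t i l *: (fun y => G y l j)) -
  (fun y => G (y + t) i j).
have phiE y : phi y = (Q t *m G y - G (t + y)) i j.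
  rewrite /phi !mxE fctE fct_sumE; congr (_ - _); last by rewrite addrC.
have dphi (y : R) : 0 <= y -> is_derive y 1 phi 0.
  move=> y0.
  have ge0 : 0 <= y + t by rewrite addr_ge0.
  have := @is_derive1_comp _ (fun y => G y i j) (shift t) y _ _
    (dG i j _ ge0) (is_derive_shift _ _ _).
  rewrite mulr1 => dl.
  apply: is_derive_eq.
    apply: is_deriveB dl.
    apply: is_derive_sum => l.
    apply: is_deriveZ; exact: dG.
  rewrite [y + t]addrC Qadd // !mxE; apply/eqP; rewrite subr_eq0; apply/eqP.
  by apply: eq_bigr.
have [||c _] := @MVT_segment R phi (fun=> 0) 0 s s0.
- by move=> x; rewrite in_itv /= => /andP[/ltW x0 _]; exact: dphi.
- apply: derivable_within_continuous => x; rewrite in_itv /= => /andP[x0 _].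
  by have [] := dphi _ x0.
rewrite mul0r => /eqP; rewrite subr_eq0 => /eqP; rewrite !phiE addr0 G0 mulmx0 sub0r.
rewrite !mxE => /eqP; rewrite subr_eq => /eqP ->.
by rewrite addrC.
Qed.

(** Since [h^-1 *: G h] tends to [1], some [G s] is invertible. Then [Q h *m G s = G (h + s) - G h]
    writes the difference quotient of [Q] at [0] as that of [G] at [s] minus that of [G] at [0],
    times [invmx (G s)], and [G] is differentiable. *)
Lemma real_semigroup_generator (R : realType) (k : nat) (Q : R -> 'M[R]_k) :
  (forall s t, 0 <= s -> 0 <= t -> Q (s + t) = Q s *m Q t) -> Q 0 = 1%:M ->
  (forall i j, {within `[0, +oo[, continuous (fun t : R => Q t i j)}) ->
  exists L : 'M[R]_k, forall i j,
    (h^-1 *: (Q h - 1%:M)) i j @[h --> (0 : R)^'+] --> L i j.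
Proof.
move=> Qadd Q0 Qc.
have /choice [g gP] : forall ij : 'I_k * 'I_k, exists G : R -> R, G 0 = 0 /\
    forall x : R, 0 <= x -> is_derive x 1 G (Q x ij.1 ij.2).
  by move=> [i j]; have [G G0 dG] := continuous_primitive _ _ (Qc i j); exists G.
pose G x := \matrix_(i, j) g (i, j) x.
have G0 : G 0 = 0 by apply/matrixP => i j; rewrite !mxE (gP (i, j)).1.
have dG i j (x : R) : 0 <= x -> is_derive x 1 (fun y => G y i j) (Q x i j).
  move=> x0; rewrite (_ : (fun y => _) = g (i, j)); first exact: (gP (i, j)).2.
  by apply/funext => y; rewrite mxE.
have QG := semigroup_primitive _ _ _ _ Qadd G0 dG.
have [s s0 Gs] : exists2 s : R, 0 < s & G s \in unitmx.
  have detG : \det (h^-1 *: G h) @[h --> (0 : R)^'+] --> \det (1%:M : 'M[R]_k).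
    apply: cvg_det => i j.
    have := right_difference_quotient _ _ _ _ (dG i j 0 (lexx 0)).
    by rewrite Q0; apply: cvg_trans; apply: near_eq_cvg; near=> h;
       rewrite add0r G0 !mxE subr0.
  rewrite det1 in detG.
  have /cvgr_neq0 := detG => /(_ (oner_neq0 _)) detN0.
  near (0 : R)^'+ => h.
  exists h => //.
  have : \det (h^-1 *: G h) != 0 by near: h.
  by rewrite detZ mulf_eq0 negb_or unitmxE unitfE => /andP[].
exists ((Q s - 1%:M) *m invmx (G s)) => i j.
pose D h := h^-1 *: ((G (s + h) - G s) - (G (0 + h) - G 0)).
have QE h : 0 <= h -> h^-1 *: (Q h - 1%:M) = D h *m invmx (G s).
  move=> h0; rewrite -scalemxAl; congr (_ *: _).
  apply: (can_inj (mulmxK Gs)); rewrite mulmxKV // mulmxBl mul1mx QG //; last exact: ltW.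
  by rewrite G0 subr0 add0r [s + h]addrC addrAC.
have DL l : D h i l @[h --> (0 : R)^'+] --> (Q s - 1%:M) i l.
  have := cvgB (right_difference_quotient _ _ _ _ (dG i l s (ltW s0)))
    (right_difference_quotient _ _ _ _ (dG i l 0 (lexx 0))).
  rewrite Q0 !mxE => H; apply: cvg_trans (H _); apply: near_eq_cvg; near=> h.
  by rewrite !mxE mulrBr !fctE !mxE.
have : (D h *m invmx (G s)) i j @[h --> (0 : R)^'+] --> ((Q s - 1%:M) *m invmx (G s)) i j.
  under eq_fun do rewrite mxE.
  rewrite mxE; apply: (@cvg_big R^o _ +%R 0 xpredT add_continuous _ _ _
    (fun l h => D h i l * invmx (G s) l j)) => l _.
  exact: (cvgM (DL l) (cvg_cst _)).
apply: cvg_trans; apply: near_eq_cvg; near=> h; rewrite -QE //.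
Unshelve. all: by end_near. Qed.

(** * Real coordinates of complex matrices *)

Lemma ReM_real (R : rcfType) (k : R) (z : R[i]) : complex.Re (k%:C * z) = k * complex.Re z.
Proof. by case: z => x y /=; rewrite mul0r subr0. Qed.
Lemma ImM_real (R : rcfType) (k : R) (z : R[i]) : complex.Im (k%:C * z) = k * complex.Im z.
Proof. by case: z => x y /=; rewrite mul0r addr0. Qed.

Lemma ler_Re_norm (R : rcfType) (z : R[i]) : (`|complex.Re z|)%:C <= `|z|.
Proof.
rewrite normc_def lecR -sqrtr_sqr ler_sqrt ?addr_ge0 ?sqr_ge0 //.
by rewrite lerDl sqr_ge0.
Qed.

Lemma ler_Im_norm (R : rcfType) (z : R[i]) : (`|complex.Im z|)%:C <= `|z|.
Proof.
rewrite normc_def lecR -sqrtr_sqr ler_sqrt ?addr_ge0 ?sqr_ge0 //.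
by rewrite lerDr sqr_ge0.
Qed.

Lemma ler_norm_ReIm (R : rcfType) (z : R[i]) :
  `|z| <= (`|complex.Re z| + `|complex.Im z|)%:C.
Proof.
rewrite normc_def lecR -[leRHS]ger0_norm ?addr_ge0 // -[leRHS]sqrtr_sqr.
rewrite ler_sqrt ?sqr_ge0 // sqrrD !real_normK ?num_real //.
rewrite -subr_ge0.
rewrite [X in 0 <= X](_ : _ = (`|complex.Re z| * `|complex.Im z|) *+ 2); last by ring.
by rewrite mulrn_wge0 // mulr_ge0.
Qed.

Lemma cvg_mx_ReIm (R : realType) (n : nat) (T : Type) (F : set_system T)
    (f : T -> 'M[R[i]]_n) (l : 'M[R[i]]_n) : Filter F ->
  (forall i j, complex.Re (f x i j) @[x --> F] --> complex.Re (l i j)) ->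
  (forall i j, complex.Im (f x i j) @[x --> F] --> complex.Im (l i j)) ->
  f @ F --> l.
Proof.
move=> FF fRe fIm; apply/cvg_ballP => -[e e'] e0; rewrite near_simpl.
(* A positive element of [R[i]] is real, so the radius has no imaginary part. *)
have [/eqP /= e'0 {}e0] : e' == 0 /\ 0 < e by apply/andP; rewrite ltcE in e0.
subst e'.
have e20 : 0 < e / 2 by rewrite divr_gt0.
have near1 i j : \forall x \near F, `|complex.Re (l i j) - complex.Re (f x i j)| < e / 2.
  by move: (fRe i j) => /cvgrPdist_lt; apply.
have near2 i j : \forall x \near F, `|complex.Im (l i j) - complex.Im (f x i j)| < e / 2.
  by move: (fIm i j) => /cvgrPdist_lt; apply.
have /filter_forall H : forall ij : 'I_n * 'I_n, \forall x \near F,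
    `|complex.Re (l ij.1 ij.2) - complex.Re (f x ij.1 ij.2)| < e / 2 /\
    `|complex.Im (l ij.1 ij.2) - complex.Im (f x ij.1 ij.2)| < e / 2.
  by move=> [i j]; apply: filterI; [exact: near1|exact: near2].
apply: filterS H => x H; split; first by rewrite ltcE /= eqxx.
move=> i j; have [] := H (i, j) => /= H1 H2.
apply: le_lt_trans (ler_norm_ReIm _ _) _.
rewrite ltcE /= eqxx /= [e]splitr.
move: H1 H2; case: (l i j) (f x i j) => [a b] [a' b'] /=; exact: ltrD.
Qed.

Lemma continuous_Re (R : realType) : continuous (fun z : R[i] => complex.Re z).
Proof.
move=> z A [e /= e0 eA]; exists e%:C; first by rewrite /= ltcR.
move=> x /= zx; apply: eA => /=; rewrite -ltcR; apply: le_lt_trans zx.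
by apply: le_trans (ler_Re_norm _ _); rewrite -raddfB.
Qed.

Lemma continuous_Im (R : realType) : continuous (fun z : R[i] => complex.Im z).
Proof.
move=> z A [e /= e0 eA]; exists e%:C; first by rewrite /= ltcR.
move=> x /= zx; apply: eA => /=; rewrite -ltcR; apply: le_lt_trans zx.
by apply: le_trans (ler_Im_norm _ _); rewrite -raddfB.
Qed.

Lemma within_continuous_entry (R : realType) (n : nat) (A : set R)
    (f : R -> 'M[R[i]]_n) (i j : 'I_n) : {within A, continuous f} ->
  {within A, continuous (fun x => complex.Re (f x i j))} /\
  {within A, continuous (fun x => complex.Im (f x i j))}.
Proof.
move=> fc.
have cc : continuous (fun M : 'M[R[i]]_n => M i j) by exact: coord_continuous.
split.
  apply: (@within_continuous_comp _ _ _ A f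
    (fun M : 'M[R[i]]_n => complex.Re (M i j))) => // M _.
  apply: (@continuous_comp _ _ _ (fun M : 'M[R[i]]_n => M i j) (fun z : R[i] => complex.Re z)).
    exact: cc.
  exact: continuous_Re.
apply: (@within_continuous_comp _ _ _ A f
  (fun M : 'M[R[i]]_n => complex.Im (M i j))) => // M _.
apply: (@continuous_comp _ _ _ (fun M : 'M[R[i]]_n => M i j) (fun z : R[i] => complex.Im z)).
  exact: cc.
exact: continuous_Im.
Qed.

Lemma cvg_mulmx (R : realType) (T : Type) (F : set_system T) (m n p : nat)
    (A : T -> 'M[R]_(m, n)) (B : T -> 'M[R]_(n, p)) (a : 'M[R]_(m, n))
    (b : 'M[R]_(n, p)) : Filter F ->
  (forall i j, A x i j @[x --> F] --> a i j) ->
  (forall i j, B x i j @[x --> F] --> b i j) ->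
  forall i j, (A x *m B x) i j @[x --> F] --> (a *m b) i j.
Proof.
move=> FF Aa Bb i j; under eq_fun do rewrite mxE.
rewrite mxE; apply: (@cvg_big R^o _ +%R 0 xpredT add_continuous _ _ _
  (fun l x => A x i l * B x l j)) => l _.
exact: (cvgM (Aa i l) (Bb l j)).
Qed.

(** Derivatives and limits are taken over [R], hence this passage to real coordinates, real parts
    first. The correspondence is linear over [R] only. *)
Definition realify {R : rcfType} {n : nat} (a : 'M[R[i]]_n) : 'rV[R]_(n * n + n * n) :=
  row_mx (mxvec (map_mx (@complex.Re R) a)) (mxvec (map_mx (@complex.Im R) a)).

Definition unrealify {R : rcfType} {n : nat} (v : 'rV[R]_(n * n + n * n)) : 'M[R[i]]_n :=
  \matrix_(i, j) (vec_mx (lsubmx v) i j +i* vec_mx (rsubmx v) i j).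

Lemma realifyK (R : rcfType) (n : nat) : cancel (@realify R n) (@unrealify R n).
Proof.
move=> a; apply/matrixP => i j; rewrite mxE row_mxKl row_mxKr !mxvecK !mxE.
by case: (a i j).
Qed.

Lemma unrealifyK (R : rcfType) (n : nat) : cancel (@unrealify R n) (@realify R n).
Proof.
move=> v; rewrite -[RHS]hsubmxK; congr row_mx; apply: (can_inj vec_mxK);
  by rewrite mxvecK; apply/matrixP => i j; rewrite !mxE.
Qed.

Lemma realify_linear (R : rcfType) (n : nat) (k : R) (a b : 'M[R[i]]_n) :
  realify (k%:C *: a + b) = k *: realify a + realify b.
Proof.
rewrite /realify scale_row_mx add_row_mx -!linearZ -!linearD /=.
by congr row_mx; congr mxvec; apply/matrixP => i j;
  rewrite !mxE raddfD /= ?ReM_real ?ImM_real.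
Qed.

Lemma realifyB (R : rcfType) (n : nat) (a b : 'M[R[i]]_n) :
  realify (a - b) = realify a - realify b.
Proof.
have := realify_linear _ _ (-1) b a.
by rewrite rmorphN1 !scaleN1r [- b + _]addrC [- realify _ + _]addrC.
Qed.

Lemma realify0 (R : rcfType) (n : nat) : realify (0 : 'M[R[i]]_n) = 0.
Proof. by rewrite -(subrr 0) realifyB subrr. Qed.

Lemma realifyZ (R : rcfType) (n : nat) (k : R) (a : 'M[R[i]]_n) :
  realify (k%:C *: a) = k *: realify a.
Proof.
by rewrite -[k%:C *: a]addr0 realify_linear realify0 addr0.
Qed.

Lemma realify_ReE (R : rcfType) (n : nat) (a : 'M[R[i]]_n) i j :
  complex.Re (a i j) = realify a 0 (lshift _ (mxvec_index i j)).
Proof. by rewrite row_mxEl mxvecE mxE. Qed.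

Lemma realify_ImE (R : rcfType) (n : nat) (a : 'M[R[i]]_n) i j :
  complex.Im (a i j) = realify a 0 (rshift _ (mxvec_index i j)).
Proof. by rewrite row_mxEr mxvecE mxE. Qed.

Lemma within_continuous_realify (R : realType) (n : nat) (A : set R)
    (f : R -> 'M[R[i]]_n) (l : 'I_(n * n + n * n)) : {within A, continuous f} ->
  {within A, continuous (fun x => realify (f x) 0 l)}.
Proof.
move=> fc; case: (split_ordP l) => m ->; case/mxvec_indexP: m => i j.
  by under eq_fun do rewrite -realify_ReE; have [] := within_continuous_entry R n A f i j fc.
by under eq_fun do rewrite -realify_ImE; have [] := within_continuous_entry R n A f i j fc.
Qed.

(** * Coordinates of the semigroup in a real basis of the algebra *)

(** Take a family in [M], free over [R], of maximal size; the dimension bounds the size. An element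
    of [M] outside its span could be appended to it. *)
Lemma real_frame (R : rcfType) (n : nat) (M : set 'M[R[i]]_n) :
  exists k (B : 'I_k -> 'M[R[i]]_n),
    let b := \matrix_i realify (B i) in
    [/\ forall i, M (B i), row_free b &
        forall f, M f -> (realify f <= b)%MS].
Proof.
pose K k := `[< exists B : 'I_k -> 'M[R[i]]_n, (forall i, M (B i)) /\
  row_free (\matrix_i realify (B i)) >].
have K0 : exists k, K k.
  exists 0%N; apply/asboolP; exists (fun=> 0); split; first by case.
  by rewrite /row_free -leqn0 rank_leq_row.
have Kle k : K k -> (k <= n * n + n * n)%N.
  by move=> /asboolP[B [_ /eqP <-]]; exact: rank_leq_col.
case: (ex_maxnP K0 Kle) => k /asboolP[B [MB Bfree]] kmax.
exists k, B; split=> // f Mf; apply/negP => /negP fB.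
suff /kmax : K (k + 1)%N by rewrite addn1 ltnn.
pose B' (i : 'I_(k + 1)) := if fintype.split i is inl j then B j else f.
apply/asboolP; exists B'; split.
  by move=> i; rewrite /B'; case: (fintype.split i).
have -> : \matrix_i realify (B' i) =
    col_mx (\matrix_i realify (B i)) (realify f).
  apply/row_matrixP => i; rewrite rowK /B'.
  by case: (split_ordP i) => j ->; rewrite ?rowKu ?rowKd ?rowK ?row_id.
(* Strict inclusion of row spaces raises the rank, so the longer family is still free. *)
have : (\matrix_i realify (B i) < \matrix_i realify (B i) + realify f)%MS.
  by rewrite ltmxE addsmxSl addsmx_sub submx_refl.
rewrite ltmxErank !addsmxE (eqP Bfree) => /andP[_ rank_gt].
by rewrite /row_free eqn_leq rank_leq_row /=; apply: leq_trans rank_gt; rewrite addn1.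
Qed.

Lemma von_neumann_lin (R : realType) (n : nat) (M : set 'M[R[i]]_n) k f g :
  von_neumann_algebra M -> M f -> M g -> M (k *: f + g).
Proof.
move=> [_ <-] Mf Mg b Mb.
by rewrite mulmxDl mulmxDr -scalemxAl -scalemxAr Mf // Mg.
Qed.

Lemma von_neumann_1 (R : realType) (n : nat) (M : set 'M[R[i]]_n) :
  von_neumann_algebra M -> M 1%:M.
Proof. by move=> [_ <-] b Mb; rewrite mul1mx mulmx1. Qed.

Lemma von_neumann_0 (R : realType) (n : nat) (M : set 'M[R[i]]_n) :
  von_neumann_algebra M -> M 0.
Proof. by move=> [_ <-] b Mb; rewrite mul0mx mulmx0. Qed.

(** On coordinate rows [P t] acts by right multiplication by its matrix [Q t] in a real basis of
    [M]. The row [v] of [f] is fixed, so all dependence on time is in [Q]. *)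
Lemma semigroup_coordinates (R : realType) (n : nat) (M : set 'M[R[i]]_n)
    (P : R -> 'M[R[i]]_n -> 'M[R[i]]_n) :
  von_neumann_algebra M -> positive_unital_semigroup M P ->
  exists k (b : 'M[R]_(k, n * n + n * n)) (Q : R -> 'M[R]_k),
  [/\ forall s t, 0 <= s -> 0 <= t -> Q (s + t) = Q s *m Q t, Q 0 = 1%:M,
    forall i j, {within `[0, +oo[, continuous (fun t : R => Q t i j)} &
    forall f, M f -> exists v : 'rV[R]_k,
      forall t, 0 <= t -> realify (P t f) = v *m Q t *m b].
Proof.
move=> MvN PM; have [k [B /= [MB bfree subb]]] := real_frame R n M.
set b := \matrix_i _ in bfree subb.
pose RP t := \matrix_i realify (P t (B i)).
have RPE t f : 0 <= t -> M f -> realify (P t f) = realify f *m pinvmx b *m RP t.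
  move=> t0 Mf; set v := realify f *m pinvmx b.
  (* Linearity of [P t] is available on [M] only, so the induction carries membership of the partial
     sums along. *)
  have [MS PS rS] : [/\ M (\sum_i (v 0 i)%:C *: B i),
      realify (P t (\sum_i (v 0 i)%:C *: B i)) = \sum_i v 0 i *: row i (RP t) &
      realify (\sum_i (v 0 i)%:C *: B i) = \sum_i v 0 i *: row i b].
    elim: (index_enum _) => [|i s [MS PS rS]].
      rewrite !big_nil; have M0 := von_neumann_0 _ _ _ MvN.
      split=> //; last exact: realify0.
      (* [P t 0 = 0] comes from linearity at [-1 *: 0 + 0]. *)
      have := semigroup_linear PM (-1) t0 M0 M0.
      by rewrite scaler0 addr0 scaleN1r addNr => ->; exact: realify0.
    rewrite !big_cons; split; first exact: von_neumann_lin.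
      by rewrite (semigroup_linear PM) // realify_linear PS rowK.
    by rewrite realify_linear rS rowK.
  have fE : f = \sum_i (v 0 i)%:C *: B i.
    apply: (can_inj (@realifyK R n)).
    by rewrite rS -mulmx_sum_row mulmxKpV // subb.
  by rewrite {1}fE PS -mulmx_sum_row.
pose Q t := RP t *m pinvmx b.
have QE t : Q t = RP t *m pinvmx b by [].
have bV : b *m pinvmx b = 1%:M by exact: mulmxVp.
(* Stability of [M] keeps the rows of [RP t] in the row space of [b], where [pinvmx b] followed by
   [b] is the identity. *)
have RPQ t : 0 <= t -> RP t = Q t *m b.
  move=> t0; rewrite /Q mulmxKpV //; apply/row_subP => i; rewrite rowK.
  by apply: subb; exact: (semigroup_stable PM).
have PQ t f : 0 <= t -> M f -> realify (P t f) = realify f *m pinvmx b *m Q t *m b.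
  by move=> t0 Mf; rewrite RPE // RPQ // !mulmxA.
have RPadd s t : 0 <= s -> 0 <= t -> RP (t + s) = Q s *m Q t *m b.
  move=> s0 t0; apply/row_matrixP => i; rewrite rowK (semigroup_add PM) //.
  rewrite PQ //; last exact: (semigroup_stable PM).
  by rewrite -!mulmxA !row_mul rowK.
exists k, b, Q; split.
- by move=> s t s0 t0; rewrite addrC QE RPadd // -mulmxA bV mulmx1.
- rewrite QE -bV; congr (_ *m _).
  by apply/row_matrixP => i; rewrite !rowK (semigroup_id PM).
- move=> i j; rewrite (_ : (fun t : R => Q t i j) =
      fun t => \sum_l realify (P t (B i)) 0 l * pinvmx b l j); last first.
    by apply/funext => t; rewrite mxE; apply: eq_bigr => l _; rewrite mxE.
  move=> t; have FF : Filter (nbhs (t : subspace `[0, +oo[%classic)) := _.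
  apply: (@cvg_big R^o _ +%R 0 xpredT add_continuous _ _ _
     (fun l (x : R) => realify (P x (B i)) 0 l * pinvmx b l j)) => l _.
  apply: cvgM; last exact: cvg_cst.
  exact: within_continuous_realify (semigroup_continuous PM (MB i)) _.
- by move=> f Mf; exists (realify f *m pinvmx b) => t t0; exact: PQ.
Qed.

(** In coordinates [P h f - f] is [v *m (Q h - 1%:M) *m b], and [Q t - Q (t - h) = Q (t - h) *m (Q h
    - 1%:M)] with [Q (t - h)] tending to [Q t]; so the right quotients at [0] and the left quotients
    at [t] have limits given by the same [L]. *)
Lemma semigroup_generator (R : realType) (n : nat) (M : set 'M[R[i]]_n)
    (P : R -> 'M[R[i]]_n -> 'M[R[i]]_n) :
  von_neumann_algebra M -> positive_unital_semigroup M P -> forall f, M f ->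
  (forall i j, realify ((h^-1)%:C *: (P h f - f)) i j @[h --> (0 : R)^'+] -->
    realify (generator P f) i j) /\
  (forall (t : R), 0 < t -> forall i j,
    realify ((h^-1)%:C *: (P t f - P (t - h) f)) i j @[h --> (0 : R)^'+] -->
    realify (generator P (P t f)) i j).
Proof.
move=> MvN PM; have [k [b [Q [Qadd Q0 Qc Pv]]]] := semigroup_coordinates _ _ _ _ MvN PM.
have [L QL] := real_semigroup_generator _ _ _ Qadd Q0 Qc.
have gen f (v : 'rV[R]_k) : (forall t, 0 <= t -> realify (P t f) = v *m Q t *m b) -> P 0 f = f ->
  (forall i j, realify ((h^-1)%:C *: (P h f - f)) i j @[h --> (0 : R)^'+] -->
    (v *m L *m b) i j) /\ realify (generator P f) = v *m L *m b.
  move=> Pf P0.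
  have cv i j : realify ((h^-1)%:C *: (P h f - f)) i j @[h --> (0 : R)^'+] -->
    (v *m L *m b) i j.
    have := cvg_mulmx _ _ _ _ _ _ _ (fun=> b) _ b _
      (cvg_mulmx _ _ _ _ _ _ (fun=> v) _ v _ _ (fun i j => cvg_cst _) QL)
      (fun i j => cvg_cst _) i j.
    move=> H; apply: cvg_trans (H _ _ _ _); apply: near_eq_cvg; near=> h.
    rewrite realifyZ realifyB -{2}P0 !Pf // Q0.
    by rewrite -mulmxBl -mulmxBr -scalemxAr -scalemxAl.
  split=> //; rewrite -[RHS]unrealifyK; congr realify.
  (* [generator] is a [lim]; in a Hausdorff space it equals the limit just found. *)
  apply: (@cvg_lim 'M[R[i]]_n); first exact: norm_hausdorff.
  apply: cvg_mx_ReIm => i j; rewrite ?realify_ReE ?realify_ImE unrealifyK.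
    by under eq_fun do rewrite realify_ReE; exact: cv.
  by under eq_fun do rewrite realify_ImE; exact: cv.
move=> f Mf; have [v Pf] := Pv f Mf; split.
  have [cv ->] := gen f v Pf (semigroup_id PM Mf); exact: cv.
move=> t t0 i j.
have [|//|_ ->] := gen (P t f) (v *m Q t).
- by move=> s s0; rewrite -(semigroup_add PM) // ?(ltW t0) // Pf ?addr_ge0 ?(ltW t0) //
    addrC Qadd ?(ltW t0) // !mulmxA.
- by apply: (semigroup_id PM); apply: (semigroup_stable PM) => //; exact: ltW.
have Qt l m : Q (t - h) l m @[h --> (0 : R)^'+] --> Q t l m.
  have Qct : {for t, continuous (fun x => Q x l m)}.
    have /continuous_within_itvcyP[Qo _] := Qc l m.
    by apply: Qo; rewrite in_itv /= t0.
  have tht : t - h @[h --> (0 : R)^'+] --> t.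
    rewrite -[X in _ --> X]subr0; apply: cvgB; first exact: cvg_cst.
    by apply: cvg_at_right_filter; exact: cvg_id.
  exact: (@cvg_comp _ _ _ (fun h => t - h) (fun x => Q x l m) _ _ _ tht Qct).
have := cvg_mulmx _ _ _ _ _ _ _ (fun=> b) _ b _
  (cvg_mulmx _ _ _ _ _ _ _ _ _ _ _
    (cvg_mulmx _ _ _ _ _ _ (fun=> v) _ v _ _ (fun i j => cvg_cst _) Qt) QL)
  (fun i j => cvg_cst _) i j.
move=> H; apply: cvg_trans (H _ _ _ _ _); apply: near_eq_cvg; near=> h.
have ht : h <= t by near: h; apply: nbhs_right_le.
rewrite realifyZ realifyB !Pf ?subr_ge0 //.
have -> : Q t = Q (t - h) *m Q h by rewrite -Qadd ?subr_ge0 // subrK.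
have QB : Q (t - h) *m Q h - Q (t - h) = Q (t - h) *m (Q h - 1%:M).
  by rewrite mulmxBr mulmx1.
rewrite -mulmxBl -mulmxBr QB.
by rewrite -!scalemxAr -!scalemxAl !mulmxA.
Unshelve. all: try by end_near. exact: ltW. Qed.

(** * Spectral calculus and Klein's inequality *)

(* Two diagonalisations of the same matrix are intertwined by a matrix whose
   nonzero entries only link equal eigenvalues. *)
Lemma diag_similar (F : fieldType) (n : nat) (U V : 'M[F]_n) (x y : 'rV[F]_n)
    (phi : F -> F) : U \in unitmx -> V \in unitmx ->
  invmx U *m diag_mx x *m U = invmx V *m diag_mx y *m V ->
  invmx U *m diag_mx (map_mx phi x) *m U = invmx V *m diag_mx (map_mx phi y) *m V.
Proof.
move=> Uu Vu /(congr1 (fun X => U *m X *m invmx V)).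
rewrite !mulmxA mulmxV // mul1mx mulmxK // => /matrixP UV.
suff E : diag_mx (map_mx phi x) *m U *m invmx V = U *m invmx V *m diag_mx (map_mx phi y).
  move: E => /(congr1 (fun X => invmx U *m X *m V)).
  by rewrite !mulmxA mulVmx // mul1mx mulmxKV.
apply/matrixP => i j; move: (UV i j).
rewrite -[diag_mx x *m U *m _]mulmxA -[diag_mx (map_mx _ _) *m U *m _]mulmxA.
move: (U *m invmx V) => T; rewrite !mul_diag_mx !mul_mx_diag !mxE.
have [->|T0] := eqVneq (T i j) 0; first by rewrite !mulr0 !mul0r.
by rewrite [RHS]mulrC => /(mulIf T0) ->; rewrite mulrC.
Qed.

(** Any unitary diagonalisation may replace the one that [fun_calculus] selects. *)
Lemma fun_calculusE (R : realType) (n : nat) (phi : R[i] -> R[i])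
    (U : 'M[R[i]]_n) (x : 'rV[R[i]]_n) : U \is unitarymx ->
  fun_calculus phi (U ^t* *m diag_mx x *m U) = U ^t* *m diag_mx (map_mx phi x) *m U.
Proof.
move=> Uu; rewrite -(invmx_unitary Uu); apply: diag_similar.
- exact: spectral_unit.
- exact: unitarymx_unit.
by apply/esym/orthomx_spectralP/orthomx_spectral_subproof; exists (U, x).
Qed.

Definition unitary_diag {R : rcfType} {n : nat} (U : 'M[R[i]]_n) (x : 'rV[R]_n) :=
  U ^t* *m diag_mx (map_mx (real_complex R) x) *m U.

Lemma adjointM (R : rcfType) (m n p : nat) (A : 'M[R[i]]_(m, n)) (B : 'M[R[i]]_(n, p)) :
  (A *m B) ^t* = B ^t* *m A ^t*.
Proof. by rewrite trmx_mul map_mxM. Qed.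

Lemma adjointE (R : rcfType) (m n : nat) (A : 'M[R[i]]_(m, n)) i j :
  (A ^t*) i j = (A j i)^*%R.
Proof. by rewrite !mxE. Qed.

Lemma mxBE (V : zmodType) (m n : nat) (A B : 'M[V]_(m, n)) i j :
  (A - B) i j = A i j - B i j.
Proof. by rewrite !mxE. Qed.

Lemma unitary_diag_herm (R : rcfType) (n : nat) (U : 'M[R[i]]_n) x :
  (unitary_diag U x) ^t* = unitary_diag U x.
Proof.
rewrite /unitary_diag !adjointM trmxCK mulmxA; congr (_ *m _ *m _).
rewrite tr_diag_mx map_diag_mx; congr diag_mx; apply/rowP => i.
by rewrite !mxE; exact: conjc_real.
Qed.

(** The adjoint of row [i] of [U] is a unit eigenvector for [x 0 i], so the quadratic form there
    reads off the eigenvalue. *)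
Lemma quad_row (R : rcfType) (n : nat) (U : 'M[R[i]]_n) (x : 'rV[R[i]]_n) i :
  U \is unitarymx ->
  (((row i U) ^t*) ^t* *m (U ^t* *m diag_mx x *m U) *m (row i U) ^t*) 0 0 = x 0 i.
Proof.
move=> Uu; rewrite trmxCK rowE adjointM !mulmxA !mulmxtVK //.
rewrite -rowE row_diag_mx -scalemxAl mxE -rowE !mxE !eqxx.
by rewrite rmorph1 mulr1.
Qed.

(** The scalar [e] covers Hermitian matrices, with [e = 1], and skew-Hermitian ones, with [e = -1];
    the relation makes [a] normal. *)
Lemma skew_hermitian_spectral (R : rcfType) (n : nat) (a : 'M[R[i]]_n) (e : R[i]) :
  a ^t* = e *: a -> let U := spectralmx a in
  [/\ U \is unitarymx, a = U ^t* *m diag_mx (spectral_diag a) *m U &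
    forall i, spectral_diag a 0 i = (((row i U) ^t*) ^t* *m a *m (row i U) ^t*) 0 0].
Proof.
move=> ae U; have Uu : U \is unitarymx by exact: spectral_unitarymx.
have aE : a = U ^t* *m diag_mx (spectral_diag a) *m U.
  rewrite -(invmx_unitary Uu); apply/orthomx_spectralP/normalmxP.
  by rewrite ae -scalemxAl -scalemxAr.
by split=> // i; rewrite [X in _ *m X *m _]aE quad_row.
Qed.

(** The matrix [a ^t* - a] is skew-Hermitian, and its quadratic form vanishes because that of [a] is
    real; so all its eigenvalues are [0]. *)
Lemma psd_herm (R : realType) (n : nat) (a : 'M[R[i]]_n) : psd a -> a ^t* = a.
Proof.
move=> pa; pose b := a ^t* - a.
have bE : b ^t* = (-1) *: b.
  by rewrite /b linearB map_mxB trmxCK scaleN1r opprB.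
have [Uu bE' d] := skew_hermitian_spectral _ _ _ _ bE.
have d0 : spectral_diag b = 0.
  apply/rowP => i; rewrite d [RHS]mxE; move: ((row i _) ^t*) => v.
  have -> : v ^t* *m b *m v = (v ^t* *m a *m v) ^t* - v ^t* *m a *m v.
    by rewrite /b mulmxBr mulmxBl !adjointM trmxCK mulmxA.
  have /ger0_real/CrealP paE := pa v.
  by rewrite mxBE adjointE paE subrr.
apply/eqP; rewrite -subr_eq0 -/b bE' d0.
by rewrite linear0 mulmx0 mul0mx.
Qed.

(** The eigenvalues are values of the quadratic form of [a] at unit vectors, so they are at least
    [e], and comparability with a real number makes them real. *)
Lemma strictly_positive_unitary_diag (R : realType) (n : nat) (a : 'M[R[i]]_n) (e : R) :
  psd (a - (e%:C)%:M) -> exists U (x : 'rV[R]_n),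
    [/\ U \is unitarymx, a = unitary_diag U x & forall i, e <= x 0 i].
Proof.
move=> pa; have := psd_herm _ _ _ pa; rewrite linearB map_mxB /=.
have -> : ((e%:C)%:M : 'M[R[i]]_n) ^t* = (e%:C)%:M.
  rewrite tr_scalar_mx map_scalar_mx; congr (_ %:M); exact: conjc_real.
move=> /addIr ah.
have [|Uu aE d] := skew_hermitian_spectral _ _ a 1; first by rewrite scale1r.
set U := spectralmx a in Uu aE d.
have EU : (e%:C)%:M = U ^t* *m diag_mx (const_mx e%:C) *m U.
  have := Uu; rewrite -trmxC_unitary => /unitarymxP; rewrite trmxCK => UU.
  by rewrite diag_const_mx mul_mx_scalar -scalemxAl UU scalemx1.
have de i : e%:C <= spectral_diag a 0 i.
  rewrite d -subr_ge0; move: (pa ((row i U) ^t*)); rewrite mulmxBr mulmxBl mxBE.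
  by rewrite EU quad_row // [X in _ - X]mxE.
exists U, (\row_i complex.Re (spectral_diag a 0 i)); split; first exact: Uu.
  rewrite {1}aE /unitary_diag.
  apply: (congr1 (fun d => U ^t* *m diag_mx d *m U)); apply/rowP => i; rewrite !mxE.
  apply/eqP; rewrite eq_complex /= eqxx /=.
  by have := de i; rewrite lecE => /andP[].
move=> i; rewrite mxE; have := de i; rewrite lecE => /andP[_]; exact.
Qed.

Lemma sqrtm_unitary_diag (R : realType) (n : nat) (U : 'M[R[i]]_n) (x : 'rV[R]_n) :
  U \is unitarymx -> (forall i, 0 <= x 0 i) ->
  sqrtm (unitary_diag U x) = unitary_diag U (map_mx Num.sqrt x).
Proof.
move=> Uu x0; rewrite /sqrtm /unitary_diag (fun_calculusE _ _ _ _ _ Uu).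
apply: (congr1 (fun d => U ^t* *m diag_mx d *m U)).
apply/rowP => i; rewrite !mxE -{1}[x 0 i]sqr_sqrtr // rmorphXn /= sqrCK //.
by rewrite ler0c sqrtr_ge0.
Qed.

Lemma logm_unitary_diag (R : realType) (n : nat) (U : 'M[R[i]]_n) (x : 'rV[R]_n) :
  U \is unitarymx -> logm (unitary_diag U x) = unitary_diag U (map_mx (@ln R) x).
Proof.
move=> Uu; rewrite /logm /unitary_diag (fun_calculusE _ _ _ _ _ Uu).
apply: (congr1 (fun d => U ^t* *m diag_mx d *m U)).
by apply/rowP => i; rewrite !mxE.
Qed.

Lemma mul_unitary_diag (R : rcfType) (n : nat) (U : 'M[R[i]]_n) (x y : 'rV[R]_n) :
  U \is unitarymx ->
  unitary_diag U x *m unitary_diag U y = unitary_diag U (\row_i (x 0 i * y 0 i)).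
Proof.
move=> Uu; rewrite /unitary_diag !mulmxA (mulmxtVK _ Uu) -[_ *m diag_mx _ *m diag_mx _]mulmxA.
rewrite mulmx_diag.
apply: (congr1 (fun d => U ^t* *m diag_mx d *m U)).
by apply/rowP => i; rewrite !mxE rmorphM.
Qed.

Lemma unitary_diag_const (R : rcfType) (n : nat) (U : 'M[R[i]]_n) (e : R) :
  U \is unitarymx -> unitary_diag U (const_mx e) = (e%:C)%:M.
Proof.
rewrite -trmxC_unitary => /unitarymxP; rewrite trmxCK => UU.
by rewrite /unitary_diag map_const_mx diag_const_mx mul_mx_scalar -scalemxAl UU scalemx1.
Qed.

Lemma absm_unitary_diag (R : realType) (n : nat) (U : 'M[R[i]]_n) (x : 'rV[R]_n) :
  U \is unitarymx -> (forall i, 0 <= x 0 i) ->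
  absm (unitary_diag U x) = unitary_diag U x.
Proof.
move=> Uu x0; rewrite /absm unitary_diag_herm (mul_unitary_diag _ _ _ _ _ Uu).
rewrite (sqrtm_unitary_diag _ _ _ _ Uu).
  apply: congr1; apply/rowP => i; rewrite !mxE -expr2 sqrtr_sqr.
  exact: ger0_norm.
by move=> i; rewrite mxE mulr_ge0.
Qed.

(** For unitary [U] and [V], the transition probability between an eigenvector of one basis and an
    eigenvector of the other. *)
Definition overlap {R : rcfType} {n : nat} (U V : 'M[R[i]]_n) (i j : 'I_n) : R :=
  (complex.Re ((U *m V ^t*) i j)) ^+ 2 + (complex.Im ((U *m V ^t*) i j)) ^+ 2.

(** Reduces trace inequalities for two Hermitian matrices, commuting or not, to inequalities between
    their eigenvalues, weighted by [overlap]. *)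
Lemma mxtrace_unitary_diag (R : rcfType) (n : nat) (U V : 'M[R[i]]_n) (x y : 'rV[R]_n) :
  \tr (unitary_diag U x *m unitary_diag V y) =
  (\sum_i \sum_j overlap U V i j * (x 0 i * y 0 j))%:C.
Proof.
rewrite /overlap /unitary_diag -!mulmxA mxtrace_mulC -!mulmxA.
have -> : V *m U ^t* = (U *m V ^t*) ^t* by rewrite adjointM trmxCK.
rewrite [U *m (_ *m (_ *m _))]mulmxA; move: (U *m V ^t*) => T.
rewrite [diag_mx _ *m (T *m _)]mulmxA /mxtrace rmorph_sum; apply: eq_bigr => i _.
rewrite mxE rmorph_sum; apply: eq_bigr => j _.
rewrite !mul_diag_mx !mxE; case: (T i j) => a b.
by apply/eqP; rewrite eq_complex /=; apply/andP; split; apply/eqP; ring.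
Qed.

Lemma overlap_ge0 (R : rcfType) (n : nat) (U V : 'M[R[i]]_n) i j :
  0 <= overlap U V i j.
Proof. by rewrite addr_ge0 ?sqr_ge0. Qed.

Lemma unitary_diag_const1 (R : rcfType) (n : nat) (U : 'M[R[i]]_n) :
  U \is unitarymx -> unitary_diag U (const_mx 1) = 1%:M.
Proof. by move=> Uu; rewrite (unitary_diag_const _ _ _ _ Uu). Qed.

(** This is [ln (1 + u) <= u] at [u = b / a - 1], multiplied by [a]. *)
Lemma ln_klein (R : realType) (a b : R) : 0 < a -> 0 < b ->
  a - b <= a * (ln a - ln b).
Proof.
move=> a0 b0; have ab0 : 0 < b / a by rewrite divr_gt0.
have := @le_ln1Dx R (b / a - 1).
rewrite [1 + _]addrC subrK ltrBrDl subrr => /(_ ab0).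
rewrite ln_div ?posrE // => H.
have := ler_wpM2l (ltW a0) H.
have -> : a * (b / a - 1) = b - a by field; rewrite gt_eqF.
by rewrite !mulrBr => H'; lra.
Qed.

Lemma ReB (R : rcfType) (z w : R[i]) : complex.Re (z - w) = complex.Re z - complex.Re w.
Proof. exact: raddfB. Qed.

(** Writing the identity as a constant diagonal in the other eigenbasis turns each of the four
    traces into a sum over pairs of eigenvalues with the same weights; [ln_klein] then holds term by
    term. *)
Lemma klein (R : realType) (n : nat) (a b U V : 'M[R[i]]_n) (x y : 'rV[R]_n) :
  U \is unitarymx -> V \is unitarymx -> a = unitary_diag U x -> b = unitary_diag V y ->
  (forall i, 0 < x 0 i) -> (forall i, 0 < y 0 i) ->
  complex.Re (\tr a) - complex.Re (\tr b) <=
  complex.Re (\tr (a *m (logm a - logm b))).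
Proof.
move=> Uu Vu aE bE x0 y0.
have one (W : 'M[R[i]]_n) : W \is unitarymx ->
    unitary_diag W (const_mx 1) = 1%:M := unitary_diag_const1 R n W.
have Ea : \tr a = (\sum_i \sum_j overlap U V i j * (x 0 i * (const_mx 1 : 'rV[R]_n) 0 j))%:C.
  by rewrite -mxtrace_unitary_diag (one _ Vu) mulmx1 -aE.
have Eb : \tr b = (\sum_i \sum_j overlap U V i j * ((const_mx 1 : 'rV[R]_n) 0 i * y 0 j))%:C.
  by rewrite -mxtrace_unitary_diag (one _ Uu) mul1mx -bE.
have Eaa : \tr (a *m logm a) = (\sum_i \sum_j overlap U V i j *
    ((\row_i (x 0 i * map_mx (@ln R) x 0 i)) 0 i * (const_mx 1 : 'rV[R]_n) 0 j))%:C.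
  rewrite -mxtrace_unitary_diag (one _ Vu) mulmx1 aE.
  by rewrite (logm_unitary_diag _ _ _ _ Uu) (mul_unitary_diag _ _ _ _ _ Uu).
have Eab : \tr (a *m logm b) = (\sum_i \sum_j overlap U V i j *
    (x 0 i * map_mx (@ln R) y 0 j))%:C.
  by rewrite -mxtrace_unitary_diag aE bE (logm_unitary_diag _ _ _ _ Vu).
move: (logm a) (logm b) Eaa Eab => la lb Eaa Eab.
rewrite mulmxBr (linearB (@mxtrace _ _)) ReB /= Ea Eb Eaa Eab /=.
rewrite -!sumrB; apply: ler_sum => i _.
rewrite -!sumrB; apply: ler_sum => j _; rewrite !mxE -!mulrBr.
apply: ler_wpM2l; first exact: overlap_ge0.
by rewrite !mulr1 mul1r -mulrBr; exact: ln_klein.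
Qed.

(** * Bounds for the logarithm *)

(** A submultiplicative norm that dominates the trace, enough for crude bounds. *)
Definition sum_norm {R : rcfType} {n : nat} (A : 'M[R[i]]_n) : R[i] :=
  \sum_i \sum_j `|A i j|.

Lemma sum_norm_row (R : rcfType) (n : nat) (A : 'M[R[i]]_n) i :
  \sum_j `|A i j| <= sum_norm A.
Proof.
rewrite /sum_norm [leRHS](bigD1 i) //= lerDl; apply: sumr_ge0 => k _.
exact: sumr_ge0.
Qed.

Lemma sum_norm_ge0 (R : rcfType) (n : nat) (A : 'M[R[i]]_n) : 0 <= sum_norm A.
Proof. by apply: sumr_ge0 => i _; exact: sumr_ge0. Qed.

Lemma sum_normM (R : rcfType) (n : nat) (A B : 'M[R[i]]_n) :
  sum_norm (A *m B) <= sum_norm A * sum_norm B.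
Proof.
rewrite {1 2}/sum_norm mulr_suml; apply: ler_sum => i _.
apply: (@le_trans _ _ (\sum_k \sum_j `|A i j| * `|B j k|)).
  apply: ler_sum => k _; rewrite mxE; apply: le_trans (ler_norm_sum _ _ _) _.
  by apply: ler_sum => j _; rewrite normrM.
rewrite exchange_big mulr_suml; apply: ler_sum => j _ /=.
by rewrite -mulr_sumr; apply: ler_wpM2l => //; exact: sum_norm_row.
Qed.

Lemma sum_normB (R : rcfType) (n : nat) (A B : 'M[R[i]]_n) :
  sum_norm (A - B) <= sum_norm A + sum_norm B.
Proof.
rewrite /sum_norm -big_split; apply: ler_sum => i _ /=.
rewrite -big_split; apply: ler_sum => j _ /=.
by rewrite !mxE; exact: ler_normB.
Qed.

Lemma norm_mxtrace (R : rcfType) (n : nat) (A : 'M[R[i]]_n) : `|\tr A| <= sum_norm A.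
Proof.
apply: le_trans (ler_norm_sum _ _ _) _; apply: ler_sum => i _.
by rewrite (bigD1 i) //= lerDl; exact: sumr_ge0.
Qed.

Lemma sum_norm_le (R : rcfType) (n : nat) (A : 'M[R[i]]_n) (k : R[i]) :
  (forall i j, `|A i j| <= k) -> sum_norm A <= (n * n)%:R * k.
Proof.
move=> Ak; apply: (@le_trans _ _ (\sum_(i < n) \sum_(j < n) k)).
  by apply: ler_sum => i _; exact: ler_sum.
by rewrite !sumr_const !card_ord -mulrnA mulr_natl.
Qed.

Lemma unitary_entry (R : rcfType) (n : nat) (U : 'M[R[i]]_n) i j :
  U \is unitarymx -> `|U i j| <= 1.
Proof.
move=> /unitarymxP/matrixP/(_ i i); rewrite !mxE eqxx => U1.
rewrite -(@ler_pXn2r _ 2) ?nnegrE // expr1n -[leRHS]U1 (bigD1 j) //=.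
rewrite adjointE normCK lerDl; apply: sumr_ge0 => k _.
by rewrite adjointE -normCK exprn_ge0.
Qed.

(** Each factor [(n * n)%:R] counts the entries of one of the three matrices in [unitary_diag U x];
    the bound does not involve [U]. *)
Lemma sum_norm_unitary_diag (R : rcfType) (n : nat) (U : 'M[R[i]]_n) (x : 'rV[R]_n) (l : R) :
  U \is unitarymx -> 0 <= l -> (forall i, `|x 0 i| <= l) ->
  sum_norm (unitary_diag U x) <= (n * n)%:R * ((n * n)%:R * l%:C) * (n * n)%:R.
Proof.
move=> Uu l0 xl.
have U1 (V : 'M[R[i]]_n) : V \is unitarymx -> sum_norm V <= (n * n)%:R.
  by move=> Vu; rewrite -[leRHS]mulr1; apply: sum_norm_le => i j; exact: unitary_entry.
have D1 : sum_norm (diag_mx (map_mx (real_complex R) x)) <= (n * n)%:R * l%:C.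
  apply: sum_norm_le => i j; rewrite !mxE.
  case: eqP => _; rewrite ?mulr1n ?mulr0n; last by rewrite normr0 ler0c.
  by apply: le_trans (ler_norm_ReIm _ _) _; rewrite /= normr0 addr0 lecR.
apply: le_trans (sum_normM _ _ _ _) _.
apply: ler_pM; rewrite ?sum_norm_ge0 //; last exact: U1.
apply: le_trans (sum_normM _ _ _ _) _.
by apply: ler_pM; [exact: sum_norm_ge0|exact: sum_norm_ge0|
  apply: U1; rewrite trmxC_unitary|exact: D1].
Qed.

Lemma abs_ln_le (R : realType) (e t x : R) : 0 < e -> e <= x -> x <= t ->
  `|ln x| <= `|ln e| + `|ln t|.
Proof.
move=> e0 ex xt; have x0 : 0 < x by exact: lt_le_trans ex.
have t0 : 0 < t by exact: lt_le_trans xt.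
have H1 : ln e <= ln x by rewrite ler_ln.
have H2 : ln x <= ln t by rewrite ler_ln.
have := ler_norm (ln t); have := ler_norm (- ln e); rewrite normrN => H3 H4.
have := normr_ge0 (ln t); have := normr_ge0 (ln e) => H5 H6.
by rewrite ler_norml; apply/andP; split; lra.
Qed.

Lemma sum_norm_log (R : realType) (n : nat) (U : 'M[R[i]]_n) (x : 'rV[R]_n) (e t : R) :
  U \is unitarymx -> 0 < e -> (forall i, e <= x 0 i) -> (forall i, x 0 i <= t) ->
  sum_norm (logm (unitary_diag U x)) <=
    (n * n)%:R * ((n * n)%:R * (`|ln e| + `|ln t|)%:C) * (n * n)%:R.
Proof.
move=> Uu e0 ex xt; rewrite (logm_unitary_diag _ _ _ _ Uu).
apply: (sum_norm_unitary_diag _ _ _ _ _ Uu) => [|i]; first by rewrite addr_ge0.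
by rewrite mxE; exact: abs_ln_le.
Qed.

(** * Relative entropy *)

Lemma psd_congr (R : realType) (n : nat) (s a : 'M[R[i]]_n) :
  s ^t* = s -> psd a -> psd (s *m a *m s).
Proof.
move=> sh pa v; have := pa (s *m v).
by rewrite adjointM sh !mulmxA.
Qed.

Lemma psdD (R : realType) (n : nat) (a b : 'M[R[i]]_n) :
  psd a -> psd b -> psd (a + b).
Proof.
by move=> pa pb v; rewrite mulmxDr mulmxDl mxE; apply: addr_ge0; [exact: pa|exact: pb].
Qed.

Lemma psdZ (R : realType) (n : nat) (e : R) (a : 'M[R[i]]_n) :
  0 <= e -> psd a -> psd (e%:C *: a).
Proof.
move=> e0 pa v; rewrite -scalemxAr -scalemxAl mxE.
by apply: mulr_ge0; [rewrite ler0c|exact: pa].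
Qed.

Lemma density_unitary_diag (R : realType) (n : nat) (rho : 'M[R[i]]_n) (e : R) :
  0 < e -> psd (rho - (e%:C)%:M) -> exists V (y : 'rV[R]_n),
    [/\ V \is unitarymx, rho = unitary_diag V y & forall i, 0 < y 0 i] /\
    (sqrtm rho) ^t* = sqrtm rho /\ sqrtm rho *m sqrtm rho = rho.
Proof.
move=> e0 pr; have [V [y [Vu rE ye]]] := strictly_positive_unitary_diag _ _ _ _ pr.
have y0 i : 0 < y 0 i by exact: lt_le_trans (ye i).
have sE : sqrtm rho = unitary_diag V (map_mx Num.sqrt y).
  by rewrite rE (sqrtm_unitary_diag _ _ _ _ Vu) => [|i]; [exact: erefl|exact: ltW].
exists V, y; split; first by split.
rewrite sE unitary_diag_herm; split; first exact: erefl.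
rewrite (mul_unitary_diag _ _ _ _ _ Vu) rE.
apply: congr1; apply/rowP => i; rewrite !mxE -expr2 sqr_sqrtr //; exact: ltW.
Qed.

(** As [sqrtm rho] squares to [rho], subtracting the scalar [e * d] from [rho_weight rho f] leaves
    the congruence of [f - e] by [sqrtm rho] plus [e] times [rho - d], a sum of two positive
    matrices. *)
Lemma rho_weight_unitary_diag (R : realType) (n : nat) (rho f : 'M[R[i]]_n) (d e : R) :
  0 < d -> psd (rho - (d%:C)%:M) -> 0 < e -> psd (f - (e%:C)%:M) ->
  exists U (x : 'rV[R]_n), [/\ U \is unitarymx, rho_weight rho f = unitary_diag U x &
    forall i, e * d <= x 0 i].
Proof.
move=> d0 pr e0 pf; have [V [y [_ [sh ss]]]] := density_unitary_diag _ _ _ _ d0 pr.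
apply: strictly_positive_unitary_diag.
have -> : rho_weight rho f - ((e * d)%:C)%:M =
    sqrtm rho *m (f - (e%:C)%:M) *m sqrtm rho + e%:C *: (rho - (d%:C)%:M).
  rewrite /rho_weight; move: (sqrtm rho) ss => s ss.
  rewrite mulmxBr mulmxBl mul_mx_scalar -scalemxAl ss scalerBr scale_scalar_mx.
  by rewrite rmorphM addrA subrK.
by apply: psdD; [exact: psd_congr|apply: psdZ => //; exact: ltW].
Qed.

(** Gradient of the entropy in directions [k] with [\tr (rho *m k) = 0]. *)
Definition entropy_gradient {R : realType} {n : nat} (rho f : 'M[R[i]]_n) : 'M[R[i]]_n :=
  sqrtm rho *m (logm (rho_weight rho f) - logm rho) *m sqrtm rho.

Lemma herm_mxtrace (R : rcfType) (n : nat) (a b : 'M[R[i]]_n) :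
  a ^t* = a -> b ^t* = b -> complex.Im (\tr (a *m b)) = 0.
Proof.
move=> ah bh; have : \tr (a *m b) \is Num.real.
  apply/CrealP; transitivity (\tr ((a *m b) ^t*)).
    by rewrite /mxtrace rmorph_sum; apply: eq_bigr => k _; rewrite adjointE.
  by rewrite adjointM ah bh mxtrace_mulC.
by move=> /complex_realP[k ->].
Qed.

Section Entropy.
Variables (R : realType) (n : nat) (rho : 'M[R[i]]_n) (d : R).
Hypotheses (d0 : 0 < d) (pr : psd (rho - (d%:C)%:M)).

Lemma logm_rho_weight_herm f : strictly_positive f ->
  (logm (rho_weight rho f) - logm rho) ^t* = logm (rho_weight rho f) - logm rho.
Proof.
move=> [e e0 pf]; have [U [x [Uu -> _]]] := rho_weight_unitary_diag _ _ _ _ _ _ d0 pr e0 pf.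
have [V [y [[Vu -> _] _]]] := density_unitary_diag _ _ _ _ d0 pr.
rewrite linearB map_mxB (logm_unitary_diag _ _ _ _ Uu).
by rewrite (logm_unitary_diag _ _ _ _ Vu) !unitary_diag_herm.
Qed.

Lemma entropy_gradient_herm f : strictly_positive f ->
  (entropy_gradient rho f) ^t* = entropy_gradient rho f.
Proof.
move=> /logm_rho_weight_herm; rewrite /entropy_gradient.
have [_ [_ [_ [sh _]]]] := density_unitary_diag _ _ _ _ d0 pr.
move: (logm _ - _) (sqrtm _) sh => X s sh Xh.
by rewrite !adjointM sh Xh mulmxA.
Qed.

Lemma mxtrace_rho_weight f : \tr (rho_weight rho f) = \tr (rho *m f).
Proof.
have [_ [_ [_ [_ ss]]]] := density_unitary_diag _ _ _ _ d0 pr.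
rewrite /rho_weight; move: (sqrtm rho) ss => s <-.
by rewrite mxtrace_mulC mulmxA.
Qed.

(** [rho_weight rho f] is positive, so the absolute value in [norm1] has no effect. *)
Lemma relative_entropyE f : strictly_positive f ->
  relative_entropy rho f =
  \tr (rho_weight rho f *m (logm (rho_weight rho f) - logm rho)) -
  \tr (rho *m f) * clog (\tr (rho *m f)).
Proof.
move=> [e e0 pf]; have [U [x [Uu wE xe]]] := rho_weight_unitary_diag _ _ _ _ _ _ d0 pr e0 pf.
rewrite /relative_entropy /norm1 -mxtrace_rho_weight wE (absm_unitary_diag _ _ _ _ Uu) //.
by move=> i; apply: le_trans (xe i); rewrite mulr_ge0 ?ltW.
Qed.

(** The order of [R[i]] compares only elements with equal imaginary parts; here they vanish because
    a product of two Hermitian matrices has real trace. *)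
Lemma relative_entropy_real f : strictly_positive f ->
  complex.Im (relative_entropy rho f) = 0.
Proof.
move=> pf; rewrite relative_entropyE // -mxtrace_rho_weight raddfB /=.
have := pf => -[e e0 pe].
have [U [x [Uu wE xe]]] := rho_weight_unitary_diag _ _ _ _ _ _ d0 pr e0 pe.
have wh : (rho_weight rho f) ^t* = rho_weight rho f by rewrite wE unitary_diag_herm.
rewrite herm_mxtrace //; last exact: logm_rho_weight_herm.
have := herm_mxtrace _ _ _ 1%:M wh; rewrite mulmx1.
rewrite tr_scalar_mx map_scalar_mx rmorph1 => /(_ erefl).
by case: (\tr _) => a b /= ->; rewrite mulr0 mul0r addr0 subr0.
Qed.

(** This is [klein] for [rho_weight rho g] against [rho_weight rho f]: equal traces remove its left
    side and the terms in [norm1], and cyclicity of the trace moves the square roots of [rho] into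
    the gradient. *)
Lemma entropy_klein f g : strictly_positive f -> strictly_positive g ->
  \tr (rho *m g) = \tr (rho *m f) ->
  complex.Re (\tr (entropy_gradient rho f *m (g - f))) <=
  complex.Re (relative_entropy rho g) - complex.Re (relative_entropy rho f).
Proof.
move=> pf pg fg; rewrite !relative_entropyE // fg -ReB opprB addrA subrK.
have := pf => -[e e0 pe].
have [U [x [Uu fE xe]]] := rho_weight_unitary_diag _ _ _ _ _ _ d0 pr e0 pe.
have := pg => -[e' e'0 pe'].
have [V [y [Vu gE ye]]] := rho_weight_unitary_diag _ _ _ _ _ _ d0 pr e'0 pe'.
have x0 i : 0 < x 0 i by apply: lt_le_trans (xe i); rewrite mulr_gt0.
have y0 i : 0 < y 0 i by apply: lt_le_trans (ye i); rewrite mulr_gt0.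
have := klein _ _ _ _ _ _ _ _ Vu Uu gE fE y0 x0.
rewrite !mxtrace_rho_weight fg subrr.
have -> : \tr (entropy_gradient rho f *m (g - f)) =
   \tr ((rho_weight rho g - rho_weight rho f) *m (logm (rho_weight rho f) - logm rho)).
  rewrite /entropy_gradient; move: (logm _ - _) => X.
  rewrite /rho_weight; move: (sqrtm _) => s.
  by rewrite -mulmxBl -mulmxBr mxtrace_mulC !mulmxA mxtrace_mulC !mulmxA.
move: (rho_weight rho f) (rho_weight rho g) => wf wg.
move: (logm wf) (logm wg) (logm rho) => lf lg l H.
(* The relative entropy of [wg] against [wf] is the difference of the two entropies minus the
   gradient term. *)
have E : wg *m (lg - lf) = wg *m (lg - l) - wf *m (lf - l) - (wg - wf) *m (lf - l).
  by rewrite !mulmxBr !mulmxBl; apply/matrixP => i j; rewrite !mxE; ring.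
rewrite {}E in H; move: (wg *m (lg - l)) (wf *m (lf - l)) ((wg - wf) *m _) H => A B C.
by rewrite !(linearB (@mxtrace _ _)) /= !ReB; lra.
Qed.

End Entropy.

(** * Differential inequalities *)

(** For a small slope [d], let [t] be the infimum of the points of [[0, T]] where [u s - d * s] is
    at least its value at [T]. Upper semicontinuity from the right puts [t] in this set, and the
    left estimate would push it further left unless [t = 0]. *)
Lemma dini_nonincreasing (R : realType) (u : R -> R) :
  (forall t, 0 < t -> forall e, 0 < e ->
    \forall h \near (0 : R)^'+, u t - u (t - h) <= e * h) ->
  (forall t, 0 <= t -> forall e, 0 < e ->
    \forall h \near (0 : R)^'+, u (t + h) <= u t + e) ->
  forall t, 0 <= t -> u t <= u 0.
Proof.
move=> uleft uright T T0; apply/ler_addgt0Pr => e e0.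
have [d d0 dT] : exists2 d, 0 < d & d * T <= e.
  (* Dividing by [T + 1] instead of [T] covers [T = 0]. *)
  exists (e / (T + 1)); first by rewrite divr_gt0 // ltr_wpDl.
  rewrite -mulrA ger_pMr // mulrC ler_pdivrMr ?ltr_wpDl // mul1r.
  by rewrite lerDl.
pose k s := u s - d * s.
pose S := [set s | 0 <= s <= T /\ k T <= k s].
have ST : S T by split; rewrite ?T0 ?lexx.
have Slb : has_lbound S by exists 0 => s [/andP[]].
have infS : has_inf S by split => //; exists T.
set t := inf S.
have t0 : 0 <= t by apply: lb_le_inf => [|s [/andP[]]//]; exists T.
have tT : t <= T by exact: ge_inf.
have kt : k T <= k t.
  rewrite leNgt; apply/negP => ktT.
  (* Points of [S] lie arbitrarily close to the right of [t], where [u] exceeds [u t] by at most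
     half the gap. *)
  have gap : 0 < (k T - k t) / 2 by rewrite divr_gt0 // subr_gt0.
  have [b /= b0 bP] := uright t t0 _ gap.
  have [s Ss st] := inf_adherent b0 infS.
  have ts : t <= s by exact: ge_inf.
  have tns : t != s by apply: contraTneq ktT => ->; rewrite -leNgt; case: Ss.
  have ts0 : 0 < s - t by rewrite subr_gt0 lt_neqAle tns.
  have := bP (s - t); rewrite /ball_ /= sub0r normrN gtr0_norm // ltrBlDl => /(_ st ts0).
  rewrite addrCA subrr addr0; case: Ss => _; rewrite /k.
  have := mulr_gt0 d0 ts0; rewrite mulrBr /k in ktT *; lra.
have [t00|tpos] : t = 0 \/ 0 < t by move: t0; rewrite le_eqVlt => /orP[/eqP|]; [left|right].
  by move: kt; rewrite t00 /k mulr0 subr0; lra.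
(* A short step to the left stays in [S], below its infimum. *)
near (0 : R)^'+ => h.
have h0 : 0 < h by near: h; exact: nbhs_right_gt.
have ht : h <= t by near: h; apply: nbhs_right_le.
have uh : u t - u (t - h) <= d * h by near: h; exact: uleft.
have : S (t - h).
  split; first by rewrite subr_ge0 ht /= lerBlDr (le_trans tT) // lerDl ltW.
  by apply: le_trans kt _; rewrite /k mulrBr; lra.
by move=> /(ge_inf Slb); rewrite -/t lerBrDl gerDr leNgt h0.
Unshelve. all: by end_near. Qed.

(** * Limits of traces through real coordinates *)

Lemma Re_mxtrace (R : rcfType) (n : nat) (Y k : 'M[R[i]]_n) :
  complex.Re (\tr (Y *m k)) = \sum_i \sum_j
    (complex.Re (Y i j) * realify k 0 (lshift _ (mxvec_index j i)) -
     complex.Im (Y i j) * realify k 0 (rshift _ (mxvec_index j i))).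
Proof.
rewrite /mxtrace raddf_sum; apply: eq_bigr => i _ /=.
rewrite mxE raddf_sum; apply: eq_bigr => j _ /=.
by rewrite -realify_ReE -realify_ImE; case: (Y i j) (k j i) => [a b] [a' b'].
Qed.

Lemma cvg_Re_mxtrace (R : realType) (n : nat) (T : Type) (F : set_system T)
    (Y : 'M[R[i]]_n) (k : T -> 'M[R[i]]_n) (l : 'M[R[i]]_n) : Filter F ->
  (forall i j, realify (k x) i j @[x --> F] --> realify l i j) ->
  complex.Re (\tr (Y *m k x)) @[x --> F] --> complex.Re (\tr (Y *m l)).
Proof.
move=> FF kl; rewrite Re_mxtrace; under eq_fun do rewrite Re_mxtrace.
apply: (@cvg_big R^o _ +%R 0 xpredT add_continuous _ _ _ (fun i x => \sum_j
    (complex.Re (Y i j) * realify (k x) 0 (lshift _ (mxvec_index j i)) -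
     complex.Im (Y i j) * realify (k x) 0 (rshift _ (mxvec_index j i))))) => i _.
apply: (@cvg_big R^o _ +%R 0 xpredT add_continuous _ _ _ (fun j x =>
    (complex.Re (Y i j) * realify (k x) 0 (lshift _ (mxvec_index j i)) -
     complex.Im (Y i j) * realify (k x) 0 (rshift _ (mxvec_index j i))))) => j _.
exact: (cvgB (cvgM (cvg_cst _) (kl _ _)) (cvgM (cvg_cst _) (kl _ _))).
Qed.

Lemma cvg_Im_mxtrace (R : realType) (n : nat) (T : Type) (F : set_system T)
    (Y : 'M[R[i]]_n) (k : T -> 'M[R[i]]_n) (l : 'M[R[i]]_n) : Filter F ->
  (forall i j, realify (k x) i j @[x --> F] --> realify l i j) ->
  complex.Im (\tr (Y *m k x)) @[x --> F] --> complex.Im (\tr (Y *m l)).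
Proof.
move=> FF kl; have ImE m : complex.Im (\tr (Y *m m)) = - complex.Re (\tr (('i%C *: Y) *m m)).
  by rewrite -scalemxAl mxtraceZ mulrC ReiNIm opprK.
by rewrite ImE; under eq_fun do rewrite ImE; apply: cvgN; exact: cvg_Re_mxtrace.
Qed.

Lemma cvg_right_within (R : realType) (q : R -> R) (t : R) :
  {within `[0, +oo[, continuous q} -> 0 <= t ->
  q (t + h) @[h --> (0 : R)^'+] --> q t.
Proof.
move=> /subspace_continuousP qc t0.
have tA : `[0, +oo[%classic t by rewrite /= in_itv /= t0.
have tht : t + h @[h --> (0 : R)^'+] --> t.
  rewrite -[X in _ --> X]addr0; apply: cvgD; first exact: cvg_cst.
  by apply: cvg_at_right_filter; exact: cvg_id.
apply: (@cvg_comp _ _ _ (fun h : R => t + h) q _ _ _ _ (qc _ tA)) => S wS.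
have : \forall h \near (0 : R)^'+, `[0, +oo[%classic (t + h) -> S (t + h) := tht _ wS.
apply: filterS2 (nbhs_right_gt 0) => h h0; apply.
by rewrite /= in_itv /= andbT addr_ge0 // ltW.
Qed.

(** Dominates [sum_norm] and is real valued, so that its limits can be read off the coordinates. *)
Definition abs_sum {R : rcfType} {n : nat} (k : 'M[R[i]]_n) : R :=
  \sum_i \sum_j (`|realify k 0 (lshift _ (mxvec_index i j))| +
                 `|realify k 0 (rshift _ (mxvec_index i j))|).

Lemma sum_norm_abs_sum (R : rcfType) (n : nat) (k : 'M[R[i]]_n) :
  sum_norm k <= (abs_sum k)%:C.
Proof.
rewrite /sum_norm /abs_sum rmorph_sum; apply: ler_sum => i _ /=.
rewrite rmorph_sum; apply: ler_sum => j _ /=.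
by rewrite -realify_ReE -realify_ImE; exact: ler_norm_ReIm.
Qed.

Lemma cvg_abs_sum0 (R : realType) (n : nat) (T : Type) (F : set_system T)
    (k : T -> 'M[R[i]]_n) : Filter F ->
  (forall i j, realify (k x) i j @[x --> F] --> (0 : R)) ->
  abs_sum (k x) @[x --> F] --> (0 : R).
Proof.
move=> FF k0; have -> : (0 : R) = \sum_(i < n) \sum_(j < n) (`|0 : R| + `|0 : R|).
  by rewrite big1 // => i _; rewrite big1 // => j _; rewrite normr0 addr0.
apply: (@cvg_big R^o _ +%R 0 xpredT add_continuous _ _ _ (fun i x => \sum_j
   (`|realify (k x) 0 (lshift _ (mxvec_index i j))| +
    `|realify (k x) 0 (rshift _ (mxvec_index i j))|))) => i _.
apply: (@cvg_big R^o _ +%R 0 xpredT add_continuous _ _ _ (fun j x =>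
   (`|realify (k x) 0 (lshift _ (mxvec_index i j))| +
    `|realify (k x) 0 (rshift _ (mxvec_index i j))|))) => j _.
by apply: cvgD; apply: cvg_norm; exact: k0.
Qed.

(** The eigenvalues of [rho_weight rho f] lie between [e * d] and their sum [\tr (rho *m f)], which
    bounds the logarithm by a constant depending on [f] only through [e] and [z]. *)
Lemma entropy_gradient_bound (R : realType) (n : nat) (rho : 'M[R[i]]_n) (d e : R) (z : R[i]) :
  0 < d -> psd (rho - (d%:C)%:M) -> 0 < e -> exists2 K : R, 0 <= K &
  forall f k, psd (f - (e%:C)%:M) -> \tr (rho *m f) = z ->
    complex.Re (\tr (entropy_gradient rho f *m k)) <= K * abs_sum k.
Proof.
move=> d0 pr e0.
pose N : R[i] := (n * n)%:R.
pose B := N * (N * (`|ln (e * d)| + `|ln (complex.Re z)|)%:C) * N.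
pose K := sum_norm (sqrtm rho) * (B + sum_norm (logm rho)) * sum_norm (sqrtm rho).
have B0 : 0 <= B by rewrite !mulr_ge0 ?ler0n // ler0c addr_ge0.
have K0 : 0 <= K by rewrite !mulr_ge0 ?addr_ge0 ?sum_norm_ge0.
have KE : K = (complex.Re K)%:C by rewrite RRe_real // ger0_real.
exists (complex.Re K) => [|f k pf fz].
  by move: K0; rewrite lecE => /andP[].
have [U [x [Uu wE xe]]] := rho_weight_unitary_diag _ _ _ _ _ _ d0 pr e0 pf.
have ed0 : 0 < e * d by rewrite mulr_gt0.
have xz i : x 0 i <= complex.Re z.
  rewrite -fz -(mxtrace_rho_weight _ _ _ _ d0 pr) wE /unitary_diag mxtrace_mulC mulmxA.
  rewrite (unitarymxP Uu) mul1mx mxtrace_diag raddf_sum (bigD1 i) //= !mxE lerDl.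
  by apply: sumr_ge0 => j _; rewrite mxE /= (le_trans (ltW ed0)).
have Lw : sum_norm (logm (rho_weight rho f)) <= B.
  by rewrite wE; exact: sum_norm_log Uu ed0 xe xz.
have YK : sum_norm (entropy_gradient rho f) <= K.
  rewrite /K; move: Lw; rewrite /entropy_gradient.
  move: (logm _) (logm _) (sqrtm _) => lw lr s Lw.
  apply: le_trans (sum_normM _ _ _ _) _.
  apply: ler_wpM2r; first exact: sum_norm_ge0.
  apply: le_trans (sum_normM _ _ _ _) _.
  apply: ler_wpM2l; first exact: sum_norm_ge0.
  apply: le_trans (sum_normB _ _ _ _) _.
  exact: lerD.
move: (entropy_gradient rho f) YK => Y YK.
rewrite -lecR rmorphM /= -KE.
apply: (@le_trans _ _ (`|complex.Re (\tr (Y *m k))|%:C)); first by rewrite lecR ler_norm.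
apply: le_trans (ler_Re_norm _ _) _.
apply: le_trans (norm_mxtrace _ _ _) _.
apply: le_trans (sum_normM _ _ _ _) _.
apply: ler_pM; [exact: sum_norm_ge0|exact: sum_norm_ge0|exact: YK|].
exact: sum_norm_abs_sum.
Qed.

(** * Strict positivity along the semigroup and the Dirichlet form *)

Lemma strictly_positive_herm (R : realType) (n : nat) (f : 'M[R[i]]_n) :
  strictly_positive f -> f ^t* = f.
Proof.
move=> [e e0 pf]; have [U [x [_ -> _]]] := strictly_positive_unitary_diag _ _ _ _ pf.
exact: unitary_diag_herm.
Qed.

(** Positivity is applied to [f] minus [e] times the identity, which [P t] fixes. *)
Lemma semigroup_lower_bound (R : realType) (n : nat) (M : set 'M[R[i]]_n)
    (P : R -> 'M[R[i]]_n -> 'M[R[i]]_n) (t e : R) (f : 'M[R[i]]_n) :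
  von_neumann_algebra M -> positive_unital_semigroup M P -> 0 <= t -> M f ->
  psd (f - (e%:C)%:M) -> psd (P t f - (e%:C)%:M).
Proof.
move=> MvN PM t0 Mf pf; have M1 := von_neumann_1 _ _ _ MvN.
have E (g : 'M[R[i]]_n) : g - (e%:C)%:M = (- e%:C) *: 1%:M + g.
  by rewrite scaleNr scalemx1 addrC.
have Ml : M ((- e%:C) *: 1%:M + f) by exact: von_neumann_lin.
have := semigroup_positive PM t0 Ml.
rewrite (semigroup_linear PM (- e%:C) t0 M1 Mf) (semigroup_unital PM t0).
by rewrite -(E f) -(E (P t f)); apply.
Qed.

Lemma semigroup_strictly_positive (R : realType) (n : nat) (M : set 'M[R[i]]_n)
    (P : R -> 'M[R[i]]_n -> 'M[R[i]]_n) (t : R) (f : 'M[R[i]]_n) :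
  von_neumann_algebra M -> positive_unital_semigroup M P -> 0 <= t -> M f ->
  strictly_positive f -> strictly_positive (P t f).
Proof.
move=> MvN PM t0 Mf [e e0 pf]; exists e; first exact: e0.
exact: (semigroup_lower_bound _ _ _ _ _ _ _ MvN PM t0 Mf pf).
Qed.

(** The difference of logarithms is Hermitian, so the adjoint in [rho_dot] disappears and the
    factors regroup into the gradient. *)
Lemma dirichlet_formE (R : realType) (n : nat)
    (P : R -> 'M[R[i]]_n -> 'M[R[i]]_n) (rho f : 'M[R[i]]_n) (d : R) :
  0 < d -> psd (rho - (d%:C)%:M) -> strictly_positive f ->
  dirichlet_form P rho (logm (rho_weight rho f) - logm rho) f =
  - \tr (entropy_gradient rho f *m generator P f).
Proof.
move=> d0 pr pf; rewrite /dirichlet_form /rho_dot (logm_rho_weight_herm _ _ _ _ d0 pr _ pf).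
by [].
Qed.

Lemma semigroup_entry_continuous (R : realType) (n : nat) (M : set 'M[R[i]]_n)
    (P : R -> 'M[R[i]]_n -> 'M[R[i]]_n) (f : 'M[R[i]]_n) (t : R) i j :
  positive_unital_semigroup M P -> M f -> 0 <= t ->
  realify (P (t + h) f - P t f) i j @[h --> (0 : R)^'+] --> (0 : R).
Proof.
move=> PM Mf t0; rewrite ord1.
have Pc := within_continuous_realify _ _ _ _ j (semigroup_continuous PM Mf).
have := cvgB (cvg_right_within _ _ t Pc t0) (cvg_cst (realify (P t f) 0 j)).
rewrite subrr => H; apply: cvg_trans (H _ _); apply: near_eq_cvg; near=> h.
by rewrite realifyB mxBE !fctE.
Unshelve. all: by end_near. Qed.

Lemma expR_right_quotient (R : realType) (a t : R) :
  h^-1 * (expR (a * (t + h)) - expR (a * t)) @[h --> (0 : R)^'+] --> a * expR (a * t).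
Proof.
have d : is_derive t 1 (fun s : R => expR (a * s)) (a * expR (a * t)).
  by apply: is_derive_eq; rewrite /GRing.scale /= mulr1 mulrC.
exact: right_difference_quotient d.
Qed.

(** Reflecting time, this is minus the right quotient of [s |-> expR (- a * s)] at [- t]. *)
Lemma expR_left_quotient (R : realType) (a t : R) :
  h^-1 * (expR (a * t) - expR (a * (t - h))) @[h --> (0 : R)^'+] --> a * expR (a * t).
Proof.
have := cvgN (expR_right_quotient _ (- a) (- t)).
rewrite mulrNN mulNr opprK => H; apply: cvg_trans (H _); apply: near_eq_cvg; near=> h.
have E : - a * (- t + h) = a * (t - h) by ring.
by rewrite !fctE /= E -mulrN opprB.
Unshelve. all: by end_near. Qed.

(** * The two implications *)

Lemma entropy_decay_dirichlet (R : realType) (n : nat) (M : set 'M[R[i]]_n)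
    (P : R -> 'M[R[i]]_n -> 'M[R[i]]_n) (rho f : 'M[R[i]]_n) (c : R) :
  von_neumann_algebra M -> positive_unital_semigroup M P ->
  faithful_invariant_density M P rho -> M f -> strictly_positive f ->
  (forall t, 0 <= t -> relative_entropy rho (P t f)
       <= (expR (- (c * t)))%:C * relative_entropy rho f) ->
  c%:C * relative_entropy rho f
       <= dirichlet_form P rho (logm (rho_weight rho f) - logm rho) f.
Proof.
move=> MvN PM rhoM Mf pf decay.
have [d d0 pr] := density_faithful rhoM.
have [cv _] := semigroup_generator _ _ _ _ MvN PM _ Mf.
have pPf t : 0 <= t -> strictly_positive (P t f).
  by move=> t0; exact: (semigroup_strictly_positive _ _ _ _ _ _ MvN PM t0 Mf pf).
rewrite (dirichlet_formE _ _ _ _ _ _ d0 pr pf).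
have YkE h : \tr (entropy_gradient rho f *m ((h^-1)%:C *: (P h f - f))) =
    (h^-1)%:C * \tr (entropy_gradient rho f *m (P h f - f)).
  by rewrite -scalemxAr mxtraceZ.
have Yh := entropy_gradient_herm _ _ _ _ d0 pr _ pf.
have klein h : 0 <= h -> complex.Re (\tr (entropy_gradient rho f *m (P h f - f))) <=
    complex.Re (relative_entropy rho (P h f)) - complex.Re (relative_entropy rho f).
  move=> h0; apply: (entropy_klein _ _ _ _ d0 pr _ _ pf (pPf _ h0)).
  exact: (density_invariant rhoM h0 Mf).
have Imf := relative_entropy_real _ _ _ _ d0 pr _ pf.
move: (entropy_gradient rho f) YkE Yh klein => Y YkE Yh klein.
have FF : Filter (0 : R)^'+ by typeclasses eauto.
have Re_cv := cvg_Re_mxtrace _ _ _ _ Y _ _ FF cv.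
have Im_cv := cvg_Im_mxtrace _ _ _ _ Y _ _ FF cv.
(* The order on [R[i]] also needs a real Dirichlet form: its imaginary part is, up to sign, a limit
   of imaginary parts of traces of products of two Hermitian matrices. *)
have Im0 : complex.Im (\tr (Y *m generator P f)) = 0.
  rewrite -(cvg_lim (@Rhausdorff R) Im_cv); apply: (cvg_lim (@Rhausdorff R)).
  apply: cvg_near_cst; near=> h.
  rewrite YkE ImM_real herm_mxtrace ?mulr0 //.
  rewrite linearB map_mxB /= (strictly_positive_herm _ _ _ pf).
  by rewrite (strictly_positive_herm _ _ _ (pPf h _)).
rewrite lecE ImM_real Imf mulr0 !raddfN /= Im0 oppr0 eqxx /=.
rewrite ReM_real lerNr -mulNr.
(* The upper bound in the comparison is the difference quotient of [expR (- c * t)] at [t = 0],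
   times the entropy of [f]. *)
have Ecv : h^-1 * (expR (- c * (0 + h)) - expR (- c * 0)) *
    complex.Re (relative_entropy rho f) @[h --> (0 : R)^'+] -->
    - c * complex.Re (relative_entropy rho f).
  have := cvgM (expR_right_quotient _ (- c) 0) (cvg_cst (complex.Re (relative_entropy rho f))).
  by rewrite mulr0 expR0 mulr1; apply.
apply: (ler_cvg_to Re_cv Ecv); near=> h.
have h0 : 0 < h by near: h; exact: nbhs_right_gt.
rewrite YkE ReM_real -mulrA; apply: ler_wpM2l; first by rewrite invr_ge0 ltW.
apply: le_trans (klein h (ltW h0)) _.
rewrite add0r mulr0 expR0 mulrBl mul1r lerD2r.
have := decay h (ltW h0); rewrite lecE ReM_real mulNr => /andP[_].
by [].
Unshelve. all: by end_near. Qed.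

(** The factor [s] serves both [t + h], with [s = 1], and [t - h], with [s = -1]. *)
Lemma cvg_expR_right (R : realType) (c t s : R) :
  expR (c * (t + s * h)) @[h --> (0 : R)^'+] --> expR (c * t).
Proof.
have H : c * (t + s * h) @[h --> (0 : R)^'+] --> c * (t + s * 0).
  apply: cvgM; first exact: cvg_cst.
  apply: cvgD; first exact: cvg_cst.
  apply: cvgM; first exact: cvg_cst.
  by apply: cvg_at_right_filter; exact: cvg_id.
rewrite mulr0 addr0 in H.
exact: (@continuous_cvg _ _ _ _ _ _ (@expR R) _ (@continuous_expR R _) H).
Qed.

Lemma dirichlet_entropy_decay (R : realType) (n : nat) (M : set 'M[R[i]]_n)
    (P : R -> 'M[R[i]]_n -> 'M[R[i]]_n) (rho f : 'M[R[i]]_n) (c : R) :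
  von_neumann_algebra M -> positive_unital_semigroup M P ->
  faithful_invariant_density M P rho ->
  (forall f, M f -> strictly_positive f -> c%:C * relative_entropy rho f
     <= dirichlet_form P rho (logm (rho_weight rho f) - logm rho) f) ->
  M f -> strictly_positive f -> forall t, 0 <= t ->
  expR (c * t) * complex.Re (relative_entropy rho (P t f)) <=
  complex.Re (relative_entropy rho f).
Proof.
move=> MvN PM rhoM dirichlet Mf pf.
have [d d0 pr] := density_faithful rhoM.
have [_ cvl] := semigroup_generator _ _ _ _ MvN PM _ Mf.
have [e e0 pe] := pf.
have MP t : 0 <= t -> M (P t f) by move=> t0; exact: (semigroup_stable PM t0 Mf).
have pPe t : 0 <= t -> psd (P t f - (e%:C)%:M).
  by move=> t0; exact: (semigroup_lower_bound _ _ _ _ _ _ _ MvN PM t0 Mf pe).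
have pPf t : 0 <= t -> strictly_positive (P t f).
  by move=> t0; exact: (semigroup_strictly_positive _ _ _ _ _ _ MvN PM t0 Mf pf).
pose E t := complex.Re (relative_entropy rho (P t f)).
pose Y t := entropy_gradient rho (P t f).
have FF : Filter (0 : R)^'+ by typeclasses eauto.
(* Klein's inequality based at [P t f] bounds the change of [E] from above by the gradient at the
   end point [t]; for [s = t - h] this controls the left quotients at [t]. *)
have klein s t : 0 <= s -> 0 <= t -> E t - E s <= complex.Re (\tr (Y t *m (P t f - P s f))).
  move=> s0 t0; rewrite -[P t f - P s f]opprB mulmxN raddfN /= raddfN /=.
  rewrite lerNr opprB; apply: (entropy_klein _ _ _ _ d0 pr _ _ (pPf _ t0) (pPf _ s0)).
  by rewrite (density_invariant rhoM s0 Mf) (density_invariant rhoM t0 Mf).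
have Edir t : 0 <= t -> c * E t <= - complex.Re (\tr (Y t *m generator P (P t f))).
  move=> t0; have := dirichlet _ (MP _ t0) (pPf _ t0).
  rewrite (dirichlet_formE _ _ _ _ _ _ d0 pr (pPf _ t0)) lecE => /andP[_].
  by rewrite ReM_real raddfN.
(* One constant serves the whole orbit: [P t f] stays above [e], and [\tr (rho *m P t f)] is
   constant. *)
have [K K0 bound] := entropy_gradient_bound _ _ _ _ _ (\tr (rho *m f)) d0 pr e0.
have EK s t : 0 <= s -> 0 <= t -> E t - E s <= K * abs_sum (P t f - P s f).
  move=> s0 t0; apply: le_trans (klein _ _ s0 t0) _.
  by apply: bound; [exact: pPe|rewrite (density_invariant rhoM t0 Mf)].
clear bound pPe pe dirichlet.
move=> T T0; have E0 : E 0 = complex.Re (relative_entropy rho f).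
  exact: (congr1 (fun g => complex.Re (relative_entropy rho g)) (semigroup_id PM Mf)).
change (expR (c * T) * E T <= complex.Re (relative_entropy rho f)).
move: (complex.Re (relative_entropy rho f)) E0 => _ <-; clearbody E.
suff : expR (c * T) * E T <= expR (c * 0) * E 0 by rewrite mulr0 expR0 mul1r.
apply: (dini_nonincreasing _ (fun t => expR (c * t) * E t) _ _ _ T0) =>
  [t t0 eta eta0|t t0 eta eta0].
  pose g h := \tr (Y t *m ((h^-1)%:C *: (P t f - P (t - h) f))).
  (* The increment of the product is split by a discrete product rule: that of [E] is weighted by
     the exponential at [t - h], that of the exponential by [E t]. *)
  have B : expR (c * (t + -1 * h)) * complex.Re (g h) +
      h^-1 * (expR (c * t) - expR (c * (t - h))) * E t @[h --> (0 : R)^'+] -->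
      expR (c * t) * complex.Re (\tr (Y t *m generator P (P t f))) + c * expR (c * t) * E t.
    apply: cvgD.
      apply: cvgM; first exact: cvg_expR_right.
      exact: (cvg_Re_mxtrace _ _ _ _ _ _ _ FF (cvl _ t0)).
    exact: (cvgM (expR_left_quotient _ c t) (cvg_cst (E t))).
  (* Condition b) at [P t f] makes the limit nonpositive. *)
  have Blt : expR (c * t) * complex.Re (\tr (Y t *m generator P (P t f))) +
      c * expR (c * t) * E t < eta.
    apply: le_lt_trans eta0; rewrite mulrAC [c * E t * _]mulrC -mulrDr.
    rewrite pmulr_rle0 ?expR_gt0 // addrC -lerBrDr sub0r; exact: Edir (ltW t0).
  near=> h.
  have h0 : 0 < h by near: h; exact: nbhs_right_gt.
  have ht : h <= t by near: h; exact: nbhs_right_le.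
  have Bh : expR (c * (t + -1 * h)) * complex.Re (g h) +
      h^-1 * (expR (c * t) - expR (c * (t - h))) * E t < eta.
    by near: h; exact: (cvgr_lt _ B _ Blt).
  have th0 : 0 <= t - h by rewrite subr_ge0.
  have kl := klein (t - h) t th0 (ltW t0).
  have gE : complex.Re (g h) = h^-1 * complex.Re (\tr (Y t *m (P t f - P (t - h) f))).
    by rewrite /g -scalemxAr mxtraceZ ReM_real.
  have := ltW Bh; rewrite gE mulN1r -(ler_pM2r h0) => {}Bh.
  apply: le_trans Bh.
  have -> : expR (c * t) * E t - expR (c * (t - h)) * E (t - h) =
      expR (c * (t - h)) * (E t - E (t - h)) +
      (expR (c * t) - expR (c * (t - h))) * E t by ring.
  set r := complex.Re _ in kl *.
  have -> : (expR (c * (t - h)) * (h^-1 * r) +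
      h^-1 * (expR (c * t) - expR (c * (t - h))) * E t) * h =
      expR (c * (t - h)) * r + (expR (c * t) - expR (c * (t - h))) * E t.
    by field; rewrite gt_eqF.
  by rewrite lerD2r; apply: ler_wpM2l kl; exact: expR_ge0.
(* Upper semicontinuity from the right: [EK] bounds [E (t + h)] by an expression that tends to
   [E t]. *)
have A : expR (c * (t + 1 * h)) * (E t + K * abs_sum (P (t + h) f - P t f))
    @[h --> (0 : R)^'+] --> expR (c * t) * (E t + K * 0).
  apply: cvgM; first exact: cvg_expR_right.
  apply: cvgD; first exact: cvg_cst.
  apply: cvgM; first exact: cvg_cst.
  apply: cvg_abs_sum0 => i j; exact: (semigroup_entry_continuous _ _ _ _ _ _ _ _ PM Mf t0).
rewrite mulr0 addr0 in A.
have At : expR (c * t) * E t < expR (c * t) * E t + eta by rewrite ltrDl.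
near=> h.
have h0 : 0 < h by near: h; exact: nbhs_right_gt.
have Ah : expR (c * (t + 1 * h)) * (E t + K * abs_sum (P (t + h) f - P t f)) <
    expR (c * t) * E t + eta by near: h; exact: (cvgr_lt _ A _ At).
apply: le_trans (ltW Ah); rewrite mul1r; apply: ler_wpM2l; first exact: expR_ge0.
rewrite -lerBlDl; apply: EK => //; by rewrite addr_ge0 // ltW.
Unshelve. all: by end_near. Qed.

Lemma lec_scale_real (R : rcfType) (a : R) (z w : R[i]) :
  complex.Im z = 0 -> complex.Im w = 0 ->
  complex.Re z <= a * complex.Re w -> z <= a%:C * w.
Proof. by move=> z0 w0 zw; rewrite lecE ImM_real ReM_real z0 w0 mulr0 eqxx. Qed.

Theorem theorem1 (R : realType) (n : nat) (M : set 'M[R[i]]_n)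
    (P : R -> 'M[R[i]]_n -> 'M[R[i]]_n) (rho : 'M[R[i]]_n) (c : R)
    (M_vN : von_neumann_algebra M)
    (P_semigroup : positive_unital_semigroup M P)
    (rho_density : faithful_invariant_density M P rho)
    (P_symmetric : symmetric_semigroup M P rho) :
  (forall (t : R) (f : 'M[R[i]]_n), 0 <= t -> M f -> strictly_positive f ->
     relative_entropy rho (P t f)
       <= (expR (- (c * t)))%:C * relative_entropy rho f)
  <->
  (forall f : 'M[R[i]]_n, M f -> strictly_positive f ->
     c%:C * relative_entropy rho f
       <= dirichlet_form P rho (logm (rho_weight rho f) - logm rho) f).
Proof.
split=> [decay f Mf pf|dirichlet t f t0 Mf pf].
  apply: (entropy_decay_dirichlet _ _ _ _ _ _ _ M_vN P_semigroup rho_density Mf pf).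
  by move=> t t0; exact: decay.
have [d d0 pr] := density_faithful rho_density.
have pPf := semigroup_strictly_positive _ _ _ _ _ _ M_vN P_semigroup t0 Mf pf.
(* Both entropies are real, so real parts suffice, and the exponential moves to the other side. *)
apply: (lec_scale_real _ _ _ _ (relative_entropy_real _ _ _ _ d0 pr _ pPf)
  (relative_entropy_real _ _ _ _ d0 pr _ pf)).
rewrite expRN -ler_pdivrMl ?invr_gt0 ?expR_gt0 // invrK.
exact: (dirichlet_entropy_decay _ _ _ _ _ _ _ M_vN P_semigroup rho_density
  dirichlet Mf pf _ t0).
Qed.
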